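(* Let $V$ be a finite-dimensional $Y_\hbar(\mathfrak g)$-module. Then, for each $i\in\mathbf I$, we have $$\sigma_i(V)=\bigcup_{\underline\mu\in\mathsf w_i^+(V)}\mathsf Z(P_{\mu_i}(u)).$$
   Context: Let $\mathfrak g$ be a finite-dimensional simple Lie algebra over $\mathbb C$ with Cartan subalgebra $\mathfrak h$, simple roots $\{\alpha_i\}_{i\in\mathbf I}$, invariant form $(\cdot,\cdot)$ normalized so that short roots have squared length $2$, Cartan matrix $a_{ij}=2(\alpha_i,\alpha_j)/(\alpha_i,\alpha_i)$, and $d_i=(\alpha_i,\alpha_i)/2$. Fix $\hbar\in\mathbb C^\times$. The Yangian $Y_\hbar(\mathfrak g)$ is the unital associative $\mathbb C$-algebra generated by $\xi_{i,r},x_{i,r}^\pm$ ($i\in\mathbf I$, $r\in\mathbb Z_{\ge0}$) with relations, for all $i,j\in\mathbf I$, $r,s\ge0$: $[\xi_{i,r},\xi_{j,s}]=0$; $[\xi_{i,0},x_{j,s}^\pm]=\pm d_ia_{ij}x_{j,s}^\pm$; $[\xi_{i,r+1},x_{j,s}^\pm]-[\xi_{i,r},x_{j,s+1}^\pm]=\pm\hbar\frac{d_ia_{ij}}2(\xi_{i,r}x_{j,s}^\pm+x_{j,s}^\pm\xi_{i,r})$; $[x^\pm_{i,r+1},x_{j,s}^\pm]-[x^\pm_{i,r},x_{j,s+1}^\pm]=\pm\hbar\frac{d_ia_{ij}}2(x^\pm_{i,r}x_{j,s}^\pm+x_{j,s}^\pm x^\pm_{i,r})$; $[x_{i,r}^+,x_{j,s}^-]=\delta_{ij}\xi_{i,r+s}$;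 and for $i\ne j$, $m=1-a_{ij}$, $\sum_{\pi\in S_m}[x^\pm_{i,r_{\pi(1)}},[x^\pm_{i,r_{\pi(2)}},\cdots[x^\pm_{i,r_{\pi(m)}},x^\pm_{j,s}]\cdots]]=0$. Set $\xi_i(u)=1+\hbar\sum_{r\ge0}\xi_{i,r}u^{-r-1}$, $x_i^\pm(u)=\hbar\sum_{r\ge0}x_{i,r}^\pm u^{-r-1}$. On a finite-dimensional representation $V$ these are expansions at $u=\infty$ of $\mathrm{End}(V)$-valued rational functions; $\sigma_i(V)\subset\mathbb C$ is the set of all poles of $\xi_i(u),x_i^+(u),x_i^-(u)$. For a tuple $\underline\mu=(\mu_j(u))_{j\in\mathbf I}$ with $\mu_j(u)=1+\hbar\sum_{r\ge0}\mu_{j,r}u^{-r-1}\in1+u^{-1}\mathbb C[[u^{-1}]]$, $V[\underline\mu]=\{v\in V:\forall j\in\mathbf I,k\ge0,\ (\xi_{j,k}-\mu_{j,k})^Nv=0\text{ for some }N>0\}$. For fixed $i\in\mathbf I$, $\underline\mu$ is an $i$-dominant weight of $V$ if $V[\underline\mu]\neq0$ and there is a (necessarily unique) monic polynomial $P_{\mu_i}(u)$ with $\mu_i(u)=\frac{P_{\mu_i}(u+\hbar d_i)}{P_{\mu_i}(u)}$. $\mathsf w_i^+(V)$ is the set of $i$-dominant weights of $V$. $\mathsf Z(P(u))$ is the set of roots of $P(u)$. *)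

(* Defs.v *)
From HB Require Import structures.
From mathcomp Require Import all_boot all_order all_algebra all_fingroup.
From mathcomp Require Import boolp classical_sets reals.
From mathcomp Require Import complex.

Set Implicit Arguments.
Unset Strict Implicit.
Unset Printing Implicit Defensive.

Import Order.TTheory GRing.Theory Num.Theory.

Local Open Scope classical_set_scope.
Local Open Scope ring_scope.
Local Open Scope complex_scope.

Section LieAlgebra.
Variables (K : fieldType) (g : vectType K) (br : g -> g -> g).

Definition lie_bracket : Prop :=
  [/\ forall x, linear (br x),
      forall y, linear (br^~ y),
      forall x, br x x = 0 &
      forall x y z, br x (br y z) + br y (br z x) + br z (br x y) = 0].

Definition lie_ideal (U : {vspace g}) : Prop :=
  forall x y, y \in U -> br x y \in U.

Definition lie_simple : Prop :=
  (exists x y, br x y <> 0) /\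
  (forall U : {vspace g}, lie_ideal U -> U = 0%VS \/ U = fullv).

Definition lie_subalgebra (h : {vspace g}) : Prop :=
  forall x y, x \in h -> y \in h -> br x y \in h.

(* [foldr br y [:: x1; ...; xn]] is [x1, [x2, ... [xn, y]]]; such elements
   span the n-th term of the lower central series. *)
Definition lie_nilpotent (h : {vspace g}) : Prop :=
  exists n : nat, forall (s : seq g) y,
    size s = n -> {subset s <= h} -> y \in h -> foldr br y s = 0.

Definition self_normalizing (h : {vspace g}) : Prop :=
  forall x, (forall y, y \in h -> br x y \in h) -> x \in h.

Definition cartan_subalgebra (h : {vspace g}) : Prop :=
  [/\ lie_subalgebra h, lie_nilpotent h & self_normalizing h].

Definition dual_space (h : {vspace g}) := 'Hom(subvs_of h, K^o).

Definition is_root (h : {vspace g}) (al : dual_space h) : Prop :=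
  al <> 0 /\
  exists2 x : g, x <> 0 & forall y : subvs_of h, br (vsval y) x = al y *: x.

Definition simple_roots (h : {vspace g}) (I : finType)
    (al : I -> dual_space h) : Prop :=
  [/\ forall i, is_root (al i),
      free [seq al i | i <- enum I] &
      forall be : dual_space h, is_root be -> exists c : I -> nat,
        be = \sum_i al i *+ c i \/ be = - (\sum_i al i *+ c i)].

Definition invariant_form (B : g -> g -> K) : Prop :=
  [/\ forall x, scalar (B x),
      forall x y, B x y = B y x,
      forall x y z, B (br x y) z = B x (br y z) &
      forall x, (forall y, B x y = 0) -> x = 0].

(* The element of [h] representing [al] through [B]; it exists and is unique
   when [B] is nondegenerate on [h], as it is on a Cartan subalgebra. *)
Definition dual_vector (B : g -> g -> K) (h : {vspace g}) (al : dual_space h) :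
    subvs_of h :=
  xget 0 [set t | forall y : subvs_of h, B (vsval t) (vsval y) = al y].

Definition dual_form (B : g -> g -> K) (h : {vspace g})
    (al be : dual_space h) : K :=
  B (vsval (dual_vector B al)) (vsval (dual_vector B be)).

End LieAlgebra.

(* In [R[i]], [2 <= z] means that [z] is real and at least 2, so the last two
   fields say that the roots of minimal length have squared length 2. *)
Record simpleLieData (R : realType) := SimpleLieData {
  lie_car : vectType R[i];
  lie_br : lie_car -> lie_car -> lie_car;
  cartan : {vspace lie_car};
  ind : finType;
  sroot : ind -> dual_space cartan;
  lie_form : lie_car -> lie_car -> R[i];
  lie_brP : lie_bracket lie_br;
  lie_simpleP : lie_simple lie_br;
  cartanP : cartan_subalgebra lie_br cartan;
  srootP : simple_roots lie_br sroot;
  lie_formP : invariant_form lie_br lie_form;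
  root_length_ge2 : forall be : dual_space cartan,
    is_root lie_br be -> 2 <= dual_form lie_form be be;
  short_root_length : exists2 be : dual_space cartan,
    is_root lie_br be & dual_form lie_form be be = 2
}.

Section CartanMatrix.
Variables (R : realType) (L : simpleLieData R).

Definition root_form (i j : ind L) : R[i] :=
  dual_form (@lie_form R L) (sroot i) (sroot j).

Definition cartan_entry (i j : ind L) : R[i] :=
  2 * root_form i j / root_form i i.

Definition symmetrizer (i : ind L) : R[i] := root_form i i / 2.

End CartanMatrix.

Section YangianRelations.
Variables (R : realType) (L : simpleLieData R) (hbar : R[i]).
Variable V : vectType R[i].
Implicit Types (xi x xp xm : ind L -> nat -> 'End(V)) (i j : ind L).

Definition comm (f g : 'End(V)) : 'End(V) := (f \o g)%VF - (g \o f)%VF.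
Definition acomm (f g : 'End(V)) : 'End(V) := (f \o g)%VF + (g \o f)%VF.

Local Notation d := (@symmetrizer R L).
Local Notation a := (@cartan_entry R L).

(* [e] is the sign of the generators [x]: 1 for x^+ and -1 for x^-. *)
Definition cartan_relations (e : R[i]) xi x : Prop :=
  (forall i j s, comm (xi i 0%N) (x j s) = (e * (d i * a i j)) *: x j s) /\
  (forall i j r s,
     comm (xi i r.+1) (x j s) - comm (xi i r) (x j s.+1)
     = (e * (hbar * (d i * a i j / 2))) *: acomm (xi i r) (x j s)).

Definition quadratic_relations (e : R[i]) x : Prop :=
  forall i j r s,
    comm (x i r.+1) (x j s) - comm (x i r) (x j s.+1)
    = (e * (hbar * (d i * a i j / 2))) *: acomm (x i r) (x j s).

(* The Cartan matrix takes values in [R[i]], so 1 - a_ij is turned into a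
   natural number by the equation on [m]. *)
Definition serre_relations x : Prop :=
  forall i j, i != j -> forall m : nat, m%:R = 1 - a i j ->
  forall (r : 'I_m -> nat) (s : nat),
    \sum_(p : 'S_m)
      foldr (fun k acc => comm (x i (r (p k))) acc) (x j s) (enum 'I_m) = 0.

Definition yangian_relations xi xp xm : Prop :=
  [/\ forall i j r s, comm (xi i r) (xi j s) = 0,
      cartan_relations 1 xi xp /\ cartan_relations (-1) xi xm,
      quadratic_relations 1 xp /\ quadratic_relations (-1) xm,
      forall i j r s,
        comm (xp i r) (xm j s) = if i == j then xi i (r + s)%N else 0 &
      serre_relations xp /\ serre_relations xm].

End YangianRelations.

(* As the Yangian is given by generators and relations, a module over it is a
   vector space with operators satisfying these relations. *)
Record yangianModule (R : realType) (L : simpleLieData R) (hbar : R[i]) :=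
  YangianModule {
    mod_car :> vectType R[i];
    xi_op : ind L -> nat -> 'End(mod_car);
    xp_op : ind L -> nat -> 'End(mod_car);
    xm_op : ind L -> nat -> 'End(mod_car);
    yangian_modP : yangian_relations hbar xi_op xp_op xm_op
  }.

Section Series.
Variables (K : fieldType) (W : lmodType K).

(* Laurent series in 1/u are given by their coefficients: [S z] is the
   coefficient of u^z.  Recall that [Negz r] is -r-1, so [series_inf c F] is
   c + \sum_r F_r u^(-r-1). *)
Definition series_inf (c : W) (F : nat -> W) (z : int) : W :=
  match z with
  | Posz 0 => c
  | Posz _.+1 => 0
  | Negz r => F r
  end.

Definition poly_series (P : seq W) (z : int) : W :=
  match z with Posz k => P`_k | Negz _ => 0 end.

Definition mul_series (q : {poly K}) (S : int -> W) (z : int) : W :=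
  \sum_(k < size q) q`_k *: S (z - k%:Z).

(* [S] is the expansion at infinity of the [W]-valued rational function P/q,
   where [P] is the list of coefficients of a [W]-valued polynomial. *)
Definition expansion_of (S : int -> W) (P : seq W) (q : {poly K}) : Prop :=
  q != 0 /\ forall z, mul_series q S z = poly_series P z.

Definition rational_series (S : int -> W) : Prop :=
  exists P q, expansion_of S P q.

Definition regular_at (S : int -> W) (a : K) : Prop :=
  exists P q, expansion_of S P q /\ q.[a] != 0.

Definition is_pole (S : int -> W) (a : K) : Prop :=
  rational_series S /\ ~ regular_at S a.

End Series.

Section Module.
Variables (R : realType) (L : simpleLieData R) (hbar : R[i]).
Variable V : yangianModule L hbar.
Implicit Types (i j : ind L) (mu : ind L -> nat -> R[i]).

Definition xi_series i : int -> 'End(V) :=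
  series_inf \1%VF (fun r => hbar *: xi_op V i r).
Definition xp_series i : int -> 'End(V) :=
  series_inf 0 (fun r => hbar *: xp_op V i r).
Definition xm_series i : int -> 'End(V) :=
  series_inf 0 (fun r => hbar *: xm_op V i r).

Definition sigma i : set R[i] :=
  [set a | [\/ is_pole (xi_series i) a,
               is_pole (xp_series i) a | is_pole (xm_series i) a]].

(* A tuple (mu_j(u))_j of series in 1 + u^-1 C[[u^-1]] is encoded by the
   coefficients mu_{j,r} in mu_j(u) = 1 + hbar \sum_r mu_{j,r} u^(-r-1). *)
Definition weight_series (mu_i : nat -> R[i]) : int -> R[i]^o :=
  series_inf (1 : R[i]^o) (fun r => hbar * mu_i r).

Definition weight_space mu : set V :=
  [set v | forall j k, exists2 N : nat, (0 < N)%N &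
     iter N (fun w => xi_op V j k w - mu j k *: w) v = 0].

Definition is_drinfeld_poly i (mu_i : nat -> R[i]) (P : {poly R[i]}) : Prop :=
  P \is monic /\
  expansion_of (weight_series mu_i)
    (P \Po ('X + (hbar * symmetrizer i)%:P) : seq R[i]^o) P.

Definition dominant_weights i : set (ind L -> nat -> R[i]) :=
  [set mu | (exists2 v : V, weight_space mu v & v <> 0) /\
            exists P, is_drinfeld_poly i (mu i) P].

Definition drinfeld_poly i (mu_i : nat -> R[i]) : {poly R[i]} :=
  xget 1 [set P | is_drinfeld_poly i mu_i P].

End Module.

Definition zeros (K : fieldType) (P : {poly K}) : set K := [set a | root P a].

(* Main.v *)
(* Only the sl2-Yangian generated by the i-th currents matters: put
   eta = hbar * d_i, and let a polynomial act on a sequence with 'X as the shift.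
   A point [a] is regular iff some [q] with [q(a) <> 0] annihilates the sequence
   x^-_r, and since [End V] is a finite-dimensional sl2-module, xi, x^+ and x^-
   have the same annihilators.  If [q] annihilates a submodule and its quotient,
   then [q^2] annihilates V; so both sides of the equality are the unions of
   those of the composition factors.

   Let V be irreducible, with highest weight vector v of weight mu and lowest
   covector phi of weight mu'.  From
     xi(u) ((u + eta) x^-_r - x^-_(r+1)) = ((u - eta) x^-_r - x^-_(r+1)) xi(u)
   every polynomial G(u) = phi(\prod_j (u x^-_(r_j) - x^-_(r_j+1)) v) solves
   mu'(u) G(u + eta) = mu(u) G(u - eta), and two solutions are proportional, their
   quotient being 2 eta-periodic.  So they are all multiples of one monic p.
   Then p annihilates x^-; it does not vanish at regular points, because there
   x^-_0 is itself of the form a R_0 - R_1 with R in the span of the x^-_r; and a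
   computation with sl2 gives mu(u) p(u) = p(u + eta).  Hence p is the Drinfeld
   polynomial of mu and its roots are the poles.  If another weight has Drinfeld
   polynomial P, a path of raising operators from it to mu gives in the same way
   a polynomial t with P(u) t(u) t(u - eta) proportional to p(u), so that the
   roots of P are roots of p. *)
Require Import Defs.
From HB Require Import structures.
From mathcomp Require Import all_boot all_order all_algebra all_fingroup.
From mathcomp Require Import boolp classical_sets reals.
From mathcomp Require Import complex.
From mathcomp Require Import ring zify.

Set Implicit Arguments.
Unset Strict Implicit.
Unset Printing Implicit Defensive.

Import Order.TTheory GRing.Theory Num.Theory.

Local Open Scope classical_set_scope.
Local Open Scope ring_scope.
Local Open Scope complex_scope.

(** * Polynomials acting on sequences *)

Section Polynomials.
Variable K : numFieldType.
Implicit Types (p q g h : {poly K}) (a u : K).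

(** Otherwise infinitely many members of the progression, distinct in characteristic 0, would be
    roots of [q]. *)
Lemma poly_eventually_neq0 q a b : q != 0 -> b != 0 ->
  exists n0, forall n, (n0 <= n)%N -> q.[a + b *+ n] != 0.
Proof.
move=> q0 b0; apply: contrapT => H.
have H' n0 : exists n, (n0 <= n)%N /\ root q (a + b *+ n).
  apply: contrapT => H1; apply: H; exists n0 => n le_n.
  by apply/negP => r0; apply: H1; exists n; rewrite rootE.
have [f Hf] := choice H'.
pose s := fix s k := if k is k'.+1 then f (s k').+1 else f 0%N.
have sm k : (s k < s k.+1)%N := proj1 (Hf (s k).+1).
have sinc : {homo s : i j / (i < j)%N} by apply: homo_ltn sm => y x z; apply: ltn_trans.
have rs k : root q (a + b *+ s k).
  by case: k => [|k]; [exact: (proj2 (Hf 0%N)) | exact: (proj2 (Hf (s k).+1))].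
pose l := [seq a + b *+ s k | k <- iota 0 (size q)].
have ul : uniq l.
  rewrite map_inj_uniq ?iota_uniq // => i j /addrI /eqP.
  rewrite -!(mulr_natr b) (inj_eq (mulfI b0)) eqr_nat => /eqP e.
  by case: (ltngtP i j) => // /sinc; rewrite e ltnn.
have := @max_poly_roots _ q l q0.
rewrite ul size_map size_iota ltnn => H1.
suff /H1 : all (root q) l by move=> /(_ isT).
by apply/allP => x /mapP[k _ ->].
Qed.

Lemma poly0_ext q h : q != 0 -> (forall u, q.[u] != 0 -> h.[u] = 0) -> h = 0.
Proof.
move=> q0 H; apply: contrapT => /eqP h0.
have qh0 : q * h != 0 by rewrite mulf_neq0.
have [n0 /(_ n0 (leqnn _))] := poly_eventually_neq0 0 qh0 (oner_neq0 K).
by rewrite hornerM; case: (eqVneq q.[0 + 1 *+ n0] 0) => [->|/H ->];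
  rewrite ?mul0r ?mulr0 eqxx.
Qed.

Lemma poly_ext_generic q g h : q != 0 ->
  (forall u, q.[u] != 0 -> g.[u] = h.[u]) -> g = h.
Proof.
move=> q0 H; apply/eqP; rewrite -subr_eq0; apply/eqP/(poly0_ext q0) => u /H.
by rewrite hornerD hornerN => ->; rewrite subrr.
Qed.

Lemma poly_ext g h : (forall u, g.[u] = h.[u]) -> g = h.
Proof. by move=> H; apply: (poly_ext_generic (oner_neq0 _)) => u _. Qed.

(* The rational function [g / h] is [b]-periodic, hence constant. *)
Lemma periodic_ratio g h b : b != 0 -> h != 0 ->
  (forall u, g.[u] * h.[u + b] = h.[u] * g.[u + b]) -> exists c, g = c *: h.
Proof.
move=> b0 h0 H.
have [n0 Hn] := poly_eventually_neq0 0 h0 b0.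
exists (g.[0 + b *+ n0] / h.[0 + b *+ n0]).
set c := _ / _.
have Hc k : g.[0 + b *+ (n0 + k)] = c * h.[0 + b *+ (n0 + k)].
  elim: k => [|k IH]; first by rewrite addn0 divfK // Hn.
  have hk : h.[0 + b *+ (n0 + k)] != 0 by rewrite Hn ?leq_addr.
  apply: (mulfI hk); rewrite addnS mulrS (addrC b) addrA -H IH; ring.
apply/eqP; rewrite -subr_eq0; apply: contraT => gh0.
have [n1 /(_ (n0 + n1)%N (leq_addl _ _))] := poly_eventually_neq0 0 gh0 b0.
by rewrite hornerD hornerN hornerZ Hc subrr eqxx.
Qed.

End Polynomials.

Section Act.
Variable K : fieldType.
Implicit Types (p q c : {poly K}).

(* [pact q F] is [q] applied to [F], where 'X acts on sequences as the shift. *)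
Definition pact (V : lmodType K) (q : {poly K}) (F : nat -> V) (r : nat) : V :=
  \sum_(k < size q) q`_k *: F (r + k)%N.

Lemma pact_trunc (V : lmodType K) q (F : nat -> V) r n : (size q <= n)%N ->
  pact q F r = \sum_(k < n) q`_k *: F (r + k)%N.
Proof.
move=> le_n; rewrite /pact (big_ord_widen n (fun k => q`_k *: F (r + k)%N)) //.
rewrite [RHS](bigID (fun k : 'I_n => (k < size q)%N)) /= [X in _ + X]big1 ?addr0 //.
by move=> k; rewrite -leqNgt => /(nth_default 0) ->; rewrite scale0r.
Qed.

Lemma pactD (V : lmodType K) p q (F : nat -> V) r :
  pact (p + q) F r = pact p F r + pact q F r.
Proof.
pose n := maxn (size p) (size q).
rewrite (@pact_trunc _ (p + q) _ _ n) ?size_polyD //.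
rewrite (@pact_trunc _ p _ _ n) ?leq_maxl // (@pact_trunc _ q _ _ n) ?leq_maxr //.
by rewrite -big_split /=; apply: eq_bigr => k _; rewrite coefD scalerDl.
Qed.

Lemma pactZ (V : lmodType K) a p (F : nat -> V) r :
  pact (a *: p) F r = a *: pact p F r.
Proof.
rewrite (@pact_trunc _ (a *: p) _ _ (size p)) ?size_scale_leq // /pact scaler_sumr.
by apply: eq_bigr => k _; rewrite coefZ scalerA.
Qed.

Lemma pactC (V : lmodType K) a (F : nat -> V) r : pact a%:P F r = a *: F r.
Proof.
by rewrite (@pact_trunc _ _ _ _ 1) ?size_polyC_leq1 // big_ord1 coefC /= addn0.
Qed.

Lemma pactMX (V : lmodType K) p (F : nat -> V) r :
  pact (p * 'X) F r = pact p F r.+1.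
Proof.
rewrite (@pact_trunc _ _ _ _ (size p).+1); last first.
  by apply: leq_trans (size_polyMleq _ _) _; rewrite size_polyX addn2.
rewrite big_ord_recl coefMX /= scale0r add0r; apply: eq_bigr => k _.
by rewrite coefMX /= addnS addSn.
Qed.

Lemma pactM (V : lmodType K) p q (F : nat -> V) r :
  pact (p * q) F r = pact p (pact q F) r.
Proof.
elim/poly_ind: p r => [|p a IH] r.
  by rewrite mul0r /pact size_poly0 !big_ord0.
rewrite mulrDl mulrAC !pactD mul_polyC pactZ pactC !pactMX IH.
by [].
Qed.

Lemma pact_linear (V W : lmodType K) (g : V -> W) q (F : nat -> V) r :
  (forall x y, g (x + y) = g x + g y) -> (forall a x, g (a *: x) = a *: g x) ->
  g (pact q F r) = pact q (g \o F) r.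
Proof.
move=> gD gZ; have g0 : g 0 = 0 by rewrite -(scale0r 0) gZ scale0r.
rewrite /pact (big_morph g gD g0); by apply: eq_bigr => k _; rewrite gZ.
Qed.

Lemma pact_apply (V W : vectType K) (g : 'Hom(V, W)) q (F : nat -> V) r :
  g (pact q F r) = pact q (fun k => g (F k)) r.
Proof. by rewrite /pact linear_sum; apply: eq_bigr => k _; rewrite linearZ. Qed.

Lemma pact_eq (V : lmodType K) q (F G : nat -> V) r : (forall s, F s = G s) ->
  pact q F r = pact q G r.
Proof. by move=> H; apply: eq_bigr => k _; rewrite H. Qed.

Lemma pact0 (V : lmodType K) q r : pact q (fun=> 0 : V) r = 0.
Proof. by apply: big1 => k _; rewrite scaler0. Qed.

(** With [c = q(u)^-1 (q - q(u)) / ('X - u)], the sequence [R = pact c F] obeys the recursion of the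
    formal sums of [F_(r+k) u^(-k-1)] over [k]. So [R_0] plays the role of the value of the series
    at [u], with one [c] for all [F] annihilated by [q]. *)
Lemma resolvent q u : q.[u] != 0 -> exists c, forall (V : lmodType K) (F : nat -> V),
  (forall r, pact q F r = 0) ->
  forall r, u *: pact c F r = F r + pact c F r.+1.
Proof.
move=> qu0.
have /factor_theorem[h Hh] : root (q - q.[u]%:P) u.
  by rewrite rootE hornerD hornerN hornerC subrr.
exists (q.[u]^-1 *: h) => V F qF r.
have E : pact (q - q.[u]%:P) F r = pact h F r.+1 - u *: pact h F r.
  by rewrite Hh mulrBr pactD pactMX [h * u%:P]mulrC mul_polyC -scaleNr pactZ scaleNr.
rewrite pactD qF add0r -polyCN pactC in E.
have -> : pact (q.[u]^-1 *: h) F r.+1 = q.[u]^-1 *: pact h F r.+1 by rewrite pactZ.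
have -> : pact h F r.+1 = u *: pact h F r - q.[u] *: F r.
  by rewrite -[LHS](subrK (u *: pact h F r)) -E addrC scaleNr.
by rewrite pactZ scalerBr !scalerA mulVf // scale1r addrC subrK mulrC.
Qed.

End Act.

(** * Joint eigenvectors and sl2-triples *)

Section LinearAlgebra.
Variables (K : numClosedFieldType) (V : vectType K).
Implicit Types (H : 'End(V)) (U W : {vspace V}) (q : {poly K}) (v w : V).

Lemma linear_ext (x y : V) :
  (forall l : V -> K, (forall v w, l (v + w) = l v + l w) ->
     (forall v, l (- v) = - l v) -> (forall a v, l (a *: v) = a * l v) ->
     l 0 = 0 -> l x = l y) -> x = y.
Proof.
move=> eq_l; rewrite (coord_vbasis (memvf x)) (coord_vbasis (memvf y)).
apply: eq_bigr => i _; congr (_ *: _); apply: eq_l => *.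
- by rewrite linearD.
- by rewrite linearN.
- by rewrite linearZ.
- by rewrite linear0.
Qed.

(** A subspace of maximal dimension inside [P] absorbs every [v] with [P v]. *)
Lemma vspace_of_pred (P : V -> Prop) :
  P 0 -> (forall a x y, P x -> P y -> P (a *: x + y)) ->
  exists U, forall v, v \in U <-> P v.
Proof.
move=> P0 PD.
pose Q k := `[< exists U, (forall v, v \in U -> P v) /\ \dim U = k >].
have exQ : exists k, Q k.
  exists 0%N; apply/asboolP; exists 0%VS; split; last by rewrite dimv0.
  by move=> v; rewrite memv0 => /eqP->.
have ubQ k : Q k -> (k <= \dim {:V})%N.
  by move=> /asboolP[U [_ <-]]; apply/dimvS/subvf.
case: (ex_maxnP exQ ubQ) => k /asboolP[U [UP <-]] maxU.
exists U => v; split=> [/UP //|Pv].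
have : Q (\dim (U + <[v]>)).
  apply/asboolP; exists (U + <[v]>)%VS; split=> // w /memv_addP[x /UP Px].
  by case=> y /vlineP[a ->] ->; rewrite addrC; apply: PD.
move=> /maxU dimle; have : (U + <[v]>)%VS == U.
  by rewrite eq_sym eqEdim addvSl.
by move=> /eqP <-; rewrite memvE addvSr.
Qed.

Lemma min_vspace (P : {vspace V} -> Prop) W0 : P W0 ->
  exists W, P W /\ forall W', P W' -> (W' <= W)%VS -> W' = W.
Proof.
move=> PW0; pose Q k := `[< exists W, P W /\ \dim W = k >].
have exQ : exists k, Q k by exists (\dim W0); apply/asboolP; exists W0.
case: (ex_minnP exQ) => k /asboolP[W [PW <-]] minW.
exists W; split=> // W' PW' sW'W; apply/eqP; rewrite eqEdim sW'W minW //.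
by apply/asboolP; exists W'.
Qed.

Lemma pact_dependence (F : nat -> V) : exists2 q : {poly K}, q != 0 & pact q F 0 = 0.
Proof.
pose n := \dim {:V}; pose X := [seq F k | k <- iota 0 n.+1].
have sX : size X = n.+1 by rewrite size_map size_iota.
have nfX : ~~ free (in_tuple X).
  apply/negP => /eqP fX; have := dimvS (subvf <<X>>%VS).
  by rewrite fX sX ltnn.
have [k [Hk [i ki]]] : exists k,
    \sum_(i < size X) k i *: X`_i = 0 /\ exists i, k i != 0.
  apply: contrapT => H; move/negP: nfX; apply; apply/freeP => k Hk i.
  by apply: contrapT => /eqP ki; apply: H; exists k; split=> //; exists i.
exists (\poly_(j < size X) if insub j is Some j' then k j' else 0).
  apply/negP => /eqP/(congr1 (fun p : {poly K} => p`_i)).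
  by rewrite coef_poly ltn_ord valK coef0 => ki0; rewrite ki0 eqxx in ki.
rewrite (pact_trunc _ _ (size_poly _ _)) -[RHS]Hk; apply: eq_bigr => j _.
rewrite coef_poly ltn_ord valK add0n (nth_map 0%N) ?nth_iota //;
  by rewrite ?size_iota -sX.
Qed.

Lemma iter_linear H k a x y :
  iter k H (a *: x + y) = a *: iter k H x + iter k H y.
Proof. by elim: k => //= k ->; rewrite linearP. Qed.

Lemma iter_lin0 H k : iter k H 0 = 0.
Proof. by elim: k => //= k ->; rewrite linear0. Qed.

Lemma pact_iterD H q a v w r : pact q (fun k => iter k H (a *: v + w)) r =
  a *: pact q (fun k => iter k H v) r + pact q (fun k => iter k H w) r.
Proof.
rewrite /pact scaler_sumr -big_split /=; apply: eq_bigr => k _.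
by rewrite iter_linear scalerDr !scalerA mulrC.
Qed.

Lemma iter_act H q w r :
  iter r H (pact q (fun k => iter k H w) 0) = pact q (fun k => iter k H w) r.
Proof.
rewrite (@pact_linear K V V (iter r H)) => [|x y|a x].
- by apply: eq_bigr => k _; rewrite /= -iterD add0n.
- by have := iter_linear H r 1 x y; rewrite !scale1r.
- by have := iter_linear H r a x 0; rewrite iter_lin0 !addr0.
Qed.

Lemma pact_iterXC H a w r :
  pact ('X - a%:P) (fun k => iter k H w) r = iter r H (H w - a *: w).
Proof.
rewrite -polyCN -['X]mul1r pactD pactMX -polyC1 !pactC scale1r.
by rewrite [LHS]addrC -scaleNr [H w + _]addrC iter_linear -iterSr.
Qed.

End LinearAlgebra.

Section Eigenvectors.
Variables (K : numClosedFieldType) (V : vectType K).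
Implicit Types (H : 'End(V)) (U W : {vspace V}) (q : {poly K}) (v w : V).

Lemma annihilating_poly H :
  exists2 q, q != 0 & forall w r, pact q (fun k => iter k H w) r = 0.
Proof.
have [q q0 Hq] := pact_dependence (fun k => iter k (comp_lfun H) \1%VF).
exists q => // w r; rewrite -iter_act -[RHS](iter_lin0 H r); congr (iter _ _ _).
have /(congr1 (fun g : 'End(V) => g w)) := Hq; rewrite zero_lfunE => <-.
rewrite (@pact_linear K _ V (fun g : 'End(V) => g w)) => [|x y|a x].
- apply: eq_bigr => k _; rewrite /= add0n; congr (_ *: _).
  by elim: (k : nat) => [|j IH] /=; rewrite ?id_lfunE // comp_lfunE IH.
- by rewrite add_lfunE.
- by rewrite scale_lfunE.
Qed.

Lemma iter_eigen H a w k : H w = a *: w -> iter k H w = a ^+ k *: w.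
Proof.
move=> Hw; elim: k => [|k IH] /=; first by rewrite scale1r.
by rewrite IH linearZ /= Hw scalerA exprSr.
Qed.

Lemma pact_eigen H q a w : H w = a *: w ->
  pact q (fun k => iter k H w) 0 = q.[a] *: w.
Proof.
move=> Hw; rewrite horner_coef scaler_suml; apply: eq_bigr => k _.
by rewrite add0n (iter_eigen _ Hw) scalerA.
Qed.

Lemma eigenvalues_bounded H (a b : K) : b != 0 -> exists k : nat,
  forall w, H w = (a + b *+ k) *: w -> w = 0.
Proof.
move=> b0; have [q q0 Hq] := annihilating_poly H.
have [k /(_ k (leqnn _)) qk] := poly_eventually_neq0 a q0 b0.
exists k => w /(pact_eigen q); rewrite Hq => /esym/eqP.
by rewrite scaler_eq0 (negbTE qk) => /eqP.
Qed.

(** Apply the linear factors of an annihilating polynomial one by one to a nonzero vector: the last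
    nonzero result is an eigenvector. *)
Lemma eigenvector_in H W : W != 0%VS -> (forall w, w \in W -> H w \in W) ->
  exists2 w, w \in W /\ w != 0 & exists a, H w = a *: w.
Proof.
move=> W0 HW; have [q q0 Hq] := annihilating_poly H.
have [rs Drs] := closed_field_poly_normal q.
have : pact (\prod_(z <- rs) ('X - z%:P)) (fun k => iter k H (vpick W)) 0 = 0.
  apply/eqP; have := Hq (vpick W) 0%N; rewrite Drs pactZ => /eqP.
  by rewrite scaler_eq0 lead_coef_eq0 (negbTE q0).
have : vpick W != 0 by rewrite vpick0.
elim: rs (vpick W) (memv_pick W) {Drs} => [|z rs IH] w wW w0.
  by rewrite big_nil -polyC1 pactC scale1r => /= w1; rewrite w1 eqxx in w0.
have [Hw _|Hw] := eqVneq (H w) (z *: w); first by exists w => //; exists z.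
rewrite big_cons mulrC pactM (pact_eq _ _ (pact_iterXC H z w)); apply: IH.
  by rewrite rpredB ?rpredZ ?HW.
by rewrite subr_eq0.
Qed.

(** In a minimal nonzero invariant subspace, an eigenspace of one [A t] is invariant by commutation,
    hence everything; so all [A t] are scalar there, however large the family. *)
Lemma joint_eigenvector (T : Type) (A : T -> 'End(V)) W0 :
  (forall s t v, A s (A t v) = A t (A s v)) -> W0 != 0%VS ->
  (forall t w, w \in W0 -> A t w \in W0) ->
  exists w, [/\ w \in W0, w != 0 & exists a, forall t, A t w = a t *: w].
Proof.
move=> Ac W00 AW0.
pose P W := [/\ W != 0%VS, (W <= W0)%VS & forall t w, w \in W -> A t w \in W].
have [|W [[Wn0 WW0 AW] minW]] := @min_vspace K V P W0; first by split.
have scal t : exists a, forall w, w \in W -> A t w = a *: w.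
  have [w [wW w0] [a Aw]] := eigenvector_in Wn0 (AW t).
  have [||U HU] := @vspace_of_pred K V (fun w => w \in W /\ A t w = a *: w).
  - by rewrite mem0v linear0 scaler0.
  - move=> b x y [xW Ax] [yW Ay]; split; first by rewrite rpredD ?rpredZ.
    by rewrite linearP /= Ax Ay scalerDr !scalerA mulrC.
  exists a => x; suff <- : U = W by case/HU.
  have sUW : (U <= W)%VS by apply/subvP => y /HU[].
  apply: minW => //; split.
  - apply/negP => /eqP U0; have /HU : w \in W /\ A t w = a *: w by [].
    by rewrite U0 memv0 (negbTE w0).
  - exact: subv_trans sUW WW0.
  - move=> s y /HU[yW Ay]; apply/HU; split; first exact: AW.
    by rewrite Ac Ay linearZ.
have [a Ha] := choice scal.
exists (vpick W); split; first exact: (subvP WW0 _ (memv_pick W)).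
  by rewrite vpick0.
by exists a => t; apply: Ha; apply: memv_pick.
Qed.

(** In the progression from [a] by [b], take the eigenspace of [xi 0] just before the first gap:
    [X t] maps it to the next one, which is zero, and it is stable under the [xi r]. *)
Lemma extreme_vector (T : Type) (xi : nat -> 'End(V)) (X : T -> 'End(V)) (b : K) :
  b != 0 -> {:V}%VS != 0%VS ->
  (forall r s v, xi r (xi s v) = xi s (xi r v)) ->
  (forall t v, xi 0%N (X t v) = X t (xi 0%N v) + b *: X t v) ->
  exists v, [/\ v != 0, exists mu, forall r, xi r v = mu r *: v
    & forall t, X t v = 0].
Proof.
move=> b0 V0 xic xiX.
have [w [_ w0] [a xiw]] := @eigenvector_in (xi 0%N) _ V0 (fun w _ => memvf _).
pose Q k := `[< forall w, xi 0%N w = (a + b *+ k) *: w -> w = 0 >].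
have exQ : exists k, Q k.
  by have [k Hk] := eigenvalues_bounded (xi 0%N) a b0; exists k; apply/asboolP.
case: (ex_minnP exQ) => -[|k] /asboolP Qk mink.
  by move/eqP: w0; case; apply: Qk; rewrite mulr0n addr0.
have /asboolP/existsNP[u /not_implyP[xiu /eqP u0]] : ~~ Q k.
  by apply/negP => /mink; rewrite ltnn.
have [||U HU] := @vspace_of_pred K V (fun w => xi 0%N w = (a + b *+ k) *: w).
- by rewrite linear0 scaler0.
- by move=> c x y xix xiy; rewrite linearP /= xix xiy scalerDr !scalerA mulrC.
have [||v [/HU vU v0 [mu xiv]]] := @joint_eigenvector nat xi U xic.
- apply/negP => /eqP U0; move/HU: xiu; rewrite U0 memv0 (negbTE u0) //.
- by move=> r x /HU xix; apply/HU; rewrite xic xix linearZ.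
exists v; split=> //; first by exists mu.
by move=> t; apply: Qk; rewrite xiX vU linearZ /= -scalerDl mulrSr addrA.
Qed.

End Eigenvectors.

Section LiftEigenvector.
Variables (K : numClosedFieldType) (V : vectType K).
Implicit Types (H : 'End(V)) (U W : {vspace V}) (q : {poly K}) (v w : V).

(** A minimal invariant subspace with a vector above an eigenvector for [mu] is a generalized
    eigenspace of each [A t] for [mu t]; so its joint eigenvectors have the eigenvalues [mu]. *)
Lemma lift_eigenvector (T : Type) (A : T -> 'End(V)) (V' : vectType K)
    (B : T -> 'End(V')) (pi : 'Hom(V, V')) mu v :
  (forall s t v, A s (A t v) = A t (A s v)) ->
  (forall t v, pi (A t v) = B t (pi v)) ->
  pi v != 0 -> (forall t, B t (pi v) = mu t *: pi v) ->
  exists2 w, w != 0 & forall t, A t w = mu t *: w.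
Proof.
move=> Ac piA pv Bv.
pose P W := (forall t w, w \in W -> A t w \in W) /\
  exists w, [/\ w \in W, pi w != 0 & forall t, B t (pi w) = mu t *: pi w].
have [|W [[AW [u [uW pu Bu]]] minW]] := @min_vspace K V P fullv.
  by split=> [t w _|]; [rewrite memvf | exists v; rewrite memvf].
have [|w [wW w0 [a Aw]]] := @joint_eigenvector K V T A W Ac _ AW.
  by apply: contraNneq pu => W0; move: uW; rewrite W0 memv0 => /eqP->; rewrite linear0.
exists w => // t; rewrite Aw; congr (_ *: _).
have [q q0 Hq] := annihilating_poly (A t).
have [n [h Hh Dq]] := multiplicity_XsubC q (mu t).
rewrite q0 /= in Hh.
pose g := ('X - (mu t)%:P) ^+ n.
have [||U HU] := @vspace_of_pred K V
    (fun w => w \in W /\ pact g (fun k => iter k (A t) w) 0 = 0).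
- split; first exact: mem0v.
  by rewrite (pact_eq _ _ (iter_lin0 _)) pact0.
- move=> b x y [xW Hx] [yW Hy]; split; first by rewrite rpredD ?rpredZ.
  by rewrite pact_iterD Hx Hy scaler0 addr0.
have UW : U = W.
  apply: minW; last by apply/subvP => x /HU[].
  split.
    move=> s x /HU[xW Hx]; apply/HU; split; first exact: AW.
    have -> : pact g (fun k => iter k (A t) (A s x)) 0 =
              A s (pact g (fun k => iter k (A t) x) 0).
      rewrite pact_apply.
      by apply: pact_eq => k; elim: k => //= k ->; rewrite Ac.
    by rewrite Hx linear0.
  (* [h] is prime to ['X - mu t]: [h(A t)] maps [u] into the generalized eigenspace and multiplies
     its image by [h(mu t) != 0]. *)
  exists (pact h (fun k => iter k (A t) u) 0).
  have piu q' : pi (pact q' (fun k => iter k (A t) u) 0) = q'.[mu t] *: pi u.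
    rewrite pact_apply.
    rewrite -(pact_eigen q' (Bu t)).
    by apply: pact_eq => k /=; elim: k => //= k <-; rewrite piA.
  split.
  - apply/HU; split.
      apply: rpred_sum => k _; apply: rpredZ.
      by elim: (k : nat) => //= j IH; apply: AW.
    rewrite (pact_eq _ _ (iter_act _ _ _)) -pactM mulrC -Dq; exact: Hq.
  - by rewrite piu scaler_eq0 negb_or pu andbT -rootE.
  - by move=> s; rewrite piu linearZ /= Bu !scalerA mulrC.
have /HU[_] : w \in U by rewrite UW.
rewrite (pact_eigen _ (Aw t)) horner_exp hornerXsubC => /eqP.
rewrite scaler_eq0 (negbTE w0) orbF expf_eq0 => /andP[_].
by rewrite subr_eq0 => /eqP.
Qed.

(** The string [F^k w] must end, and [E F^(k+1) w = d (k+1) (n - k) F^k w] only lets it end after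
    [k = n]. *)
Lemma sl2_weight (E F H : 'End(V)) (d n : K) w : d != 0 ->
  (forall v, E (F v) = F (E v) + H v) ->
  (forall v, H (F v) = F (H v) - (2 * d) *: F v) ->
  w != 0 -> E w = 0 -> H w = (d * n) *: w ->
  exists k : nat, [/\ n = k%:R, iter k F w != 0 & iter k.+1 F w = 0].
Proof.
move=> d0 EF HF w0 Ew Hw.
have HFk k : H (iter k F w) = (d * n - 2 * d *+ k) *: iter k F w.
  elim: k => [|k IH]; first by rewrite subr0.
  by rewrite iterS HF IH linearZ /= -scalerBl mulrSr; congr (_ *: _); ring.
have EFk k : E (iter k.+1 F w) = (d * k.+1%:R * (n - k%:R)) *: iter k F w.
  elim: k => [|k IH]; first by rewrite /= EF Ew linear0 add0r Hw; congr (_ *: _); ring.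
  rewrite [iter k.+2 _ _]iterS EF IH linearZ /= -iterS HFk -scalerDl.
  by congr (_ *: _); ring.
pose Q k := iter k F w == 0.
have exQ : exists k, Q k.
  have [|k Hk] := @eigenvalues_bounded K V H (d * n) (- (2 * d)).
    by rewrite oppr_eq0 mulf_neq0 // pnatr_eq0.
  by exists k; apply/eqP/Hk; rewrite HFk mulNrn.
case: (ex_minnP exQ) => -[|k] /eqP Qk mink.
  by rewrite -[_ == _]/(iter 0 F w == 0) Qk eqxx in w0.
have Fk : iter k F w != 0 by apply/negP => /mink; rewrite ltnn.
exists k; split=> //; have := EFk k; rewrite Qk linear0 => /esym/eqP.
rewrite scaler_eq0 (negbTE Fk) orbF !mulf_eq0 (negbTE d0) pnatr_eq0 /= subr_eq0.
by move/eqP.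
Qed.

End LiftEigenvector.

(* Reduces an identity in a vector space to scalars, leaving it to [ring]. *)
Ltac vring :=
  let l := fresh "l" in let lD := fresh "lD" in let lN := fresh "lN" in
  let lZ := fresh "lZ" in let l0 := fresh "l0" in
  apply: linear_ext; intros l lD lN lZ l0;
  rewrite ?(lD, lN, lZ, l0); ring.

(** * Covectors and the transposed action *)

Section Transpose.
Variables (K : numClosedFieldType) (V : vectType K).
Implicit Types (g : 'End(V)) (phi : 'Hom(V, K^o)) (v : V).

Definition precomp g phi : 'Hom(V, K^o) := (phi \o g)%VF.

Lemma precomp_is_linear g : linear (precomp g).
Proof. by move=> a x y; rewrite /precomp comp_lfunDl comp_lfunZl. Qed.

HB.instance Definition _ g :=
  GRing.isLinear.Build K _ _ *:%R (precomp g) (precomp_is_linear g).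

Definition transp g : 'End('Hom(V, K^o)) := linfun (precomp g).

Lemma transpE g phi v : transp g phi v = phi (g v).
Proof. by rewrite lfunE /= comp_lfunE. Qed.

Lemma iter_transp g phi k v : iter k (transp g) phi v = phi (iter k g v).
Proof. by elim: k v => //= k IH v; rewrite transpE IH -iterSr. Qed.

Lemma covector_neq0 phi : phi != 0 -> exists v, phi v != 0.
Proof.
move=> /eqP phi0; apply: contrapT => H; apply: phi0; apply/lfunP => v.
by rewrite zero_lfunE; apply: contrapT => /eqP Hv; apply: H; exists v.
Qed.

Lemma dual_neq0 : {:V}%VS != 0%VS -> {: 'Hom(V, K^o)}%VS != 0%VS.
Proof.
rewrite -!dimv_eq0 !dimvf => V0.
have -> : dim 'Hom(V, K^o) = (dim V * 1)%N by [].
by rewrite muln1.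
Qed.

(** Transposition reverses products, which turns the step [b] of weights into [- b]. *)
Lemma extreme_covector (T : Type) (xi : nat -> 'End(V)) (X : T -> 'End(V)) (b : K) :
  b != 0 -> {:V}%VS != 0%VS ->
  (forall r s v, xi r (xi s v) = xi s (xi r v)) ->
  (forall t v, xi 0%N (X t v) = X t (xi 0%N v) + b *: X t v) ->
  exists phi, [/\ phi != 0, exists mu : nat -> K, forall r v, phi (xi r v) = mu r * phi v
    & forall t v, phi (X t v) = 0].
Proof.
move=> b0 V0 xiC xiX.
have [||||phi [phi0 [mu Hmu] HX]] := @extreme_vector K _ T
    (fun r => transp (xi r)) (fun t => transp (X t)) (- b).
- by rewrite oppr_eq0.
- exact: dual_neq0.
- by move=> r s phi; apply/lfunP => v; rewrite !transpE xiC.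
- move=> t phi; apply/lfunP => v; rewrite add_lfunE scale_lfunE !transpE xiX.
  by rewrite linearD /= linearZ /= scaleNr addrK.
exists phi; split=> //.
- by exists mu => r v; rewrite -transpE Hmu scale_lfunE.
- by move=> t v; rewrite -transpE HX zero_lfunE.
Qed.

(** The transposes of [E], [F] and [- H] form again an sl2-triple, for which [phi] is a highest
    weight vector. *)
Lemma sl2_coweight (E F H : 'End(V)) (d n : K) phi : d != 0 ->
  (forall v, E (F v) = F (E v) + H v) ->
  (forall v, H (F v) = F (H v) - (2 * d) *: F v) ->
  phi != 0 -> (forall v, phi (E v) = 0) ->
  (forall v, phi (H v) = - (d * n) * phi v) ->
  exists k : nat, n = k%:R /\ exists v, phi (iter k F v) != 0.
Proof.
move=> d0 EF HF phi0 phiE phiH.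
have [|||||k [nk /covector_neq0[v Hv] _]] :=
    @sl2_weight K _ (transp E) (transp F) (- transp H) d n phi d0.
- move=> psi; apply/lfunP => v; rewrite add_lfunE opp_lfunE opp_lfunE !transpE EF.
  by rewrite linearD /= addrK.
- move=> psi; apply/lfunP => v.
  rewrite !(add_lfunE, opp_lfunE, scale_lfunE, transpE) HF linearB /= linearZ /=.
  by rewrite opprB addrAC subrr add0r.
- by [].
- by apply/lfunP => v; rewrite transpE phiE zero_lfunE.
- apply/lfunP => v; rewrite opp_lfunE opp_lfunE transpE phiH scale_lfunE.
  by rewrite mulNr opprK.
by exists k; split=> //; exists v; rewrite -iter_transp.
Qed.

End Transpose.

Section Commutators.
Variables (K : numClosedFieldType) (V : vectType K).
Implicit Types (a b h X : 'End(V)).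

Definition adf a X : 'End(V) := (a \o X)%VF - (X \o a)%VF.

Lemma adf_is_linear a : linear (adf a).
Proof.
move=> c x y; apply/lfunP => v; rewrite !lfun_simp !linearP /=.
vring.
Qed.

HB.instance Definition _ a :=
  GRing.isLinear.Build K _ _ *:%R (adf a) (adf_is_linear a).

(* [End V] is a finite-dimensional sl2-module, so that a lowest weight vector
   of positive weight vanishes in it. *)
Lemma lowest_positive_eq0 a b h X (d : K) : d != 0 ->
  (forall v, a (b v) = b (a v) + h v) ->
  (forall v, h (b v) = b (h v) - (2 * d) *: b v) ->
  (forall v, a (X v) = X (a v)) ->
  (forall v, h (X v) = X (h v) - (2 * d) *: X v) -> X = 0.
Proof.
move=> d0 ab hb aX hX; apply/eqP; apply: contraT => X0.
have [||||k [/eqP Hk _ _]] := @sl2_weight K _ (linfun (adf a)) (linfun (adf b))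
    (linfun (adf h)) d (- 2) X d0 _ _ X0.
- move=> Y; apply/lfunP => v; rewrite !(lfun_simp, lfunE) /= !(lfun_simp, linearB) /=.
  by rewrite !ab !linearD /=; vring.
- move=> Y; apply/lfunP => v; rewrite !(lfun_simp, lfunE) /= !(lfun_simp, linearB) /=.
  by rewrite !hb !(linearB, linearZ) /=; vring.
- by rewrite lfunE; apply/lfunP => v; rewrite /= /adf !lfun_simp aX subrr.
- rewrite lfunE; apply/lfunP => v; rewrite /= /adf !lfun_simp hX; vring.
by rewrite eq_sym -subr_eq0 opprK -natrD pnatr_eq0 addn_eq0 andbF in Hk.
Qed.

End Commutators.

(** * Series and currents *)

Section SeriesAct.
Variables (K : fieldType) (W : lmodType K).
Implicit Types (q : {poly K}) (c : W) (F : nat -> W).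

Lemma mul_series_neg q c F r : mul_series q (series_inf c F) (Negz r) = pact q F r.
Proof.
apply: eq_bigr => k _; congr (_ *: _).
suff -> : Negz r - k%:Z = Negz (r + k) by [].
by rewrite !NegzE -addSn PoszD opprD.
Qed.

Lemma mul_series_large q c F n : (size q <= n)%N ->
  mul_series q (series_inf c F) n = 0.
Proof.
move=> le_n; apply: big1 => k _.
have lt_kn : (k < n)%N by apply: leq_trans le_n.
by rewrite subzn 1?ltnW //; case: (n - k)%N (subn_gt0 k n) => [|j]; rewrite ?lt_kn // scaler0.
Qed.

Lemma annihilator_expansion q c F : q != 0 -> (forall r, pact q F r = 0) ->
  exists P, expansion_of (series_inf c F) P q.
Proof.
move=> q0 Hq; exists (mkseq (fun n => mul_series q (series_inf c F) n) (size q)).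
split=> // -[n|r]; last by rewrite mul_series_neg Hq.
rewrite /=; have [lt_n|le_n] := ltnP n (size q); first by rewrite nth_mkseq.
by rewrite nth_default ?size_mkseq // mul_series_large.
Qed.

(** The negative coefficients of [q S] are [pact q F] and those from [size q] on vanish, so a
    numerator exists as soon as [q] annihilates [F]. *)
Lemma regular_atP c F a :
  regular_at (series_inf c F) a <->
  exists2 q : {poly K}, q.[a] != 0 & forall r, pact q F r = 0.
Proof.
split=> [[P [q [[q0 Hq] qa]]]|[q qa Hq]].
  by exists q => // r; rewrite -(mul_series_neg q c) Hq.
have [|P HP] := annihilator_expansion (q := q) c _ Hq; last by exists P, q.
by apply: contraNneq qa => ->; rewrite horner0.
Qed.

Lemma pact_scale q b F r : pact q (fun k => b *: F k) r = b *: pact q F r.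
Proof.
by rewrite /pact scaler_sumr; apply: eq_bigr => k _; rewrite !scalerA mulrC.
Qed.

End SeriesAct.

Section Numerator.
Variables (K : fieldType) (hbar : K).
Implicit Types (q P : {poly K}) (mu : nat -> K).

Definition cseries mu : int -> K^o :=
  series_inf (1 : K^o) (fun r => hbar * mu r).

(* The polynomial part of the product of [q] and [mu(u)]. *)
Definition numer q mu : {poly K} :=
  \poly_(n < size q) mul_series q (cseries mu) n.

Lemma numer_coef q mu n : (numer q mu)`_n = mul_series q (cseries mu) n.
Proof.
rewrite coef_poly; case: ltnP => // le_n.
by rewrite /cseries mul_series_large.
Qed.

Lemma numer_eval q mu (u : K) (R : nat -> K^o) :
  (forall r, u * R r = mu r + R r.+1) -> pact q R 0 = 0 ->
  (numer q mu).[u] = q.[u] * (1 + hbar * R 0%N).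
Proof.
move=> HR qR.
(* The value [1 + hbar R_0] of [mu(u)], times [u^k], exceeds the polynomial part of [u^k mu(u)] by
   [hbar R_k]; summed against [q], these excesses vanish because [pact q R 0 = 0]. *)
have partial k N : (k < N)%N -> \sum_(n < N) cseries mu (n%:Z - k%:Z) * u ^+ n =
    u ^+ k * (1 + hbar * R 0%N) - hbar * R k.
  elim: k N => [|k IH] [|N] // lt_k; rewrite big_ord_recl expr0 mulr1.
    rewrite big1 => [|n _]; last by rewrite subr0 /= mul0r.
    by rewrite subr0 /= addr0 mul1r addrK.
  have -> : cseries mu (0%N%:Z - k.+1%:Z) = hbar * mu k.
    by rewrite sub0r -NegzE.
  have -> : \sum_(n < N) cseries mu ((lift ord0 n)%:Z - k.+1%:Z) * u ^+ lift ord0 n =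
      u * \sum_(n < N) cseries mu (n%:Z - k%:Z) * u ^+ n.
    rewrite big_distrr; apply: eq_bigr => n _ /=.
    rewrite /bump leq0n add1n exprS mulrCA; congr (_ * (cseries mu _ * _)).
    by rewrite -addn1 -[k.+1]addn1 !PoszD opprD addrACA subrr addr0.
  rewrite IH // mulrBr mulrA -exprS mulrCA HR; ring.
have -> : (numer q mu).[u] =
    \sum_(k < size q) q`_k * (u ^+ k * (1 + hbar * R 0%N) - hbar * R k).
  rewrite horner_poly /mul_series.
  under eq_bigr do rewrite mulr_suml.
  rewrite exchange_big /=; apply: eq_bigr => k _.
  rewrite -(partial _ (size q)) // mulr_sumr; apply: eq_bigr => n _.
  by rewrite mulrA.
under eq_bigr do rewrite mulrBr mulrA.
rewrite sumrB -mulr_suml -horner_coef.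
suff -> : \sum_(k < size q) q`_k * (hbar * R k) = 0 by rewrite subr0.
transitivity (hbar * pact q R 0); last by rewrite qR mulr0.
by rewrite mulr_sumr; apply: eq_bigr => k _; rewrite add0n mulrCA.
Qed.

Lemma size_numer q mu : q != 0 -> size (numer q mu) = size q.
Proof.
move=> q0; have sq : (0 < size q)%N by rewrite size_poly_gt0.
apply: size_poly_eq; rewrite /mul_series -(prednK sq) big_ord_recr big1 /= => [|k _].
  by rewrite add0r subrr [_ *: _]mulr1 /= -lead_coefE lead_coef_eq0.
rewrite subzn 1?ltnW // /cseries.
by case: (_ - _)%N (subn_gt0 k (size q).-1) => [|j]; rewrite ?ltn_ord // scaler0.
Qed.

Lemma expansion_ofP (N P : {poly K}) mu : hbar != 0 ->
  expansion_of (cseries mu) (N : seq K^o) P <->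
  [/\ P != 0, forall r, pact P (mu : nat -> K^o) r = 0 & N = numer P mu].
Proof.
move=> hbar0; have pactP r : mul_series P (cseries mu) (Negz r) =
    hbar * pact P (mu : nat -> K^o) r.
  by rewrite /cseries mul_series_neg pact_scale.
split=> [[P0 H]|[P0 H ->]].
  split=> // [r|].
    have /eqP := H (Negz r); rewrite pactP /= mulf_eq0 (negbTE hbar0) /=.
    by move/eqP.
  by apply/polyP => n; rewrite numer_coef H.
split=> // -[n|r]; first by rewrite -numer_coef.
by rewrite pactP H mulr0.
Qed.

End Numerator.

Section Currents.
Variables (K : numClosedFieldType) (hbar : K) (V : vectType K).
Implicit Types (Z : 'End(V)) (v w : V) (zs : seq ('End(V) * 'End(V))) (q : {poly K}).

(* The relations between [xi] and two consecutive coefficients of [x^+]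
   ([theta = d]) or [x^-] ([theta = -d]); they are linear in [(Z0, Z1)]. *)
Definition current (xi : nat -> 'End(V)) (theta : K) Z0 Z1 : Prop :=
  (forall w, xi 0%N (Z0 w) = Z0 (xi 0%N w) + (2 * theta) *: Z0 w) /\
  (forall r w, xi r.+1 (Z0 w) = Z0 (xi r.+1 w) + (xi r (Z1 w) - Z1 (xi r w))
     + (hbar * theta) *: (xi r (Z0 w) + Z0 (xi r w))).

Lemma current0 xi theta : current xi theta 0 0.
Proof. by split=> [w|r w]; rewrite !zero_lfunE !linear0; vring. Qed.

Lemma currentD xi theta a Z0 Z1 Y0 Y1 :
  current xi theta Z0 Z1 -> current xi theta Y0 Y1 ->
  current xi theta (a *: Z0 + Y0) (a *: Z1 + Y1).
Proof.
move=> [Z0h Zr] [Y0h Yr]; split=> [w|r w]; rewrite !(add_lfunE, scale_lfunE) !linearP /=.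
  by rewrite Z0h Y0h; vring.
by rewrite Zr Yr; vring.
Qed.

Lemma current_act xi theta (x : nat -> 'End(V)) q r :
  (forall s, current xi theta (x s) (x s.+1)) ->
  current xi theta (pact q x r) (pact q x r.+1).
Proof.
move=> cx; rewrite /pact; elim/big_rec2: _ => [|k Z1 Z0 _ cZ]; first exact: current0.
exact: currentD.
Qed.

(** With [Z0 = 0], the relation for [r = 0] says that [Z1] commutes with [xi_0], but [Z1] has the
    nonzero weight [2 * theta]. *)
Lemma current_zero xi theta Z1 Z2 : theta != 0 -> current xi theta 0 Z1 ->
  current xi theta Z1 Z2 -> Z1 = 0.
Proof.
move=> theta0 [_ H0] [H1 _]; apply/lfunP => w.
have := H0 0%N w; rewrite !zero_lfunE !linear0 !(add0r, addr0) scaler0 addr0 H1.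
rewrite addrC addKr => /esym/eqP.
by rewrite scaler_eq0 mulf_eq0 pnatr_eq0 (negbTE theta0) => /eqP.
Qed.

Definition Zword zs w := foldr (fun (z : 'End(V) * 'End(V)) w => z.1 w) w zs.
Definition Yword u zs w := foldr (fun (z : 'End(V) * 'End(V)) w => u *: z.1 w - z.2 w) w zs.
Definition xword (x : nat -> 'End(V)) (s : seq nat) := [seq (x r, x r.+1) | r <- s].

(** Recursion on the covector produces a scalar polynomial directly, whose value at [u] is
    [phi (Yword u zs v)]. *)
Fixpoint Gpoly (phi : 'Hom(V, K^o)) zs v : {poly K} :=
  if zs is z :: zs' then
    'X * Gpoly (phi \o z.1)%VF zs' v - Gpoly (phi \o z.2)%VF zs' v
  else (phi v : K)%:P.

Lemma Gpoly_eval phi zs v u : (Gpoly phi zs v).[u] = phi (Yword u zs v).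
Proof.
elim: zs phi => [|z zs IH] phi /=; first by rewrite hornerC.
by rewrite hornerD hornerN hornerM hornerX !IH !comp_lfunE linearB linearZ.
Qed.

Lemma size_Gpoly phi zs v : (size (Gpoly phi zs v) <= (size zs).+1)%N.
Proof.
elim: zs phi => [|z zs IH] phi /=; first exact: size_polyC_leq1.
apply: leq_trans (size_polyD _ _) _; rewrite geq_max size_polyN.
rewrite (leq_trans (IH _)) // andbT mulrC.
apply: leq_trans (size_polyMleq _ _) _; rewrite size_polyX addn2 /=.
exact: IH.
Qed.

Lemma coef_Gpoly phi zs v : (Gpoly phi zs v)`_(size zs) = phi (Zword zs v).
Proof.
elim: zs phi => [|z zs IH] phi /=; first by rewrite coefC.
rewrite coefB coefXM /= IH comp_lfunE nth_default ?subr0 //.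
exact: size_Gpoly.
Qed.

Lemma Zword_cat zs zs' w : Zword (zs ++ zs') w = Zword zs (Zword zs' w).
Proof. exact: foldr_cat. Qed.

Lemma Zword_linear zs a v w : Zword zs (a *: v + w) = a *: Zword zs v + Zword zs w.
Proof. by elim: zs => //= z zs ->; rewrite linearP. Qed.

Variables (xi : nat -> 'End(V)) (theta : K).

Definition currents zs := forall z, z \in zs -> current xi theta z.1 z.2.

Lemma Zword_weight zs w (l : K) : currents zs -> xi 0%N w = l *: w ->
  xi 0%N (Zword zs w) = (l + 2 * theta *+ size zs) *: Zword zs w.
Proof.
move=> + Hw; elim: zs => [|z zs IH] Hzs /=; first by rewrite addr0.
have [-> _] := Hzs z (mem_head _ _).
rewrite IH => [|y ?]; last by apply: Hzs; rewrite inE orbC; apply/orP; left.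
by rewrite linearZ /= -scalerDl [_ *+ (size zs).+1]mulrSr addrA.
Qed.

(* The value of [xi(u)] when [R] is the value of [\sum_r xi_r u^(-r-1)]. *)
Definition xival (R : nat -> 'End(V)) w := w + hbar *: R 0%N w.

Section Value.
Variables (q c : {poly K}) (u : K).
Hypothesis Hc : forall (W : lmodType K) (F : nat -> W), (forall r, pact q F r = 0) ->
  forall r, u *: pact c F r = F r + pact c F r.+1.
Hypothesis qxi : forall r, pact q xi r = 0.
Let R r := pact c xi r.

(** These are the relations times [u^(-r-1)], summed over [r]; the resolvent replaces the sum, and
    [u R_0 = xi_0 + R_1] accounts for the shift of index. *)
Lemma xival_current Z0 Z1 w : current xi theta Z0 Z1 ->
  xival R ((u - hbar * theta) *: Z0 w - Z1 w) =
  (u + hbar * theta) *: Z0 (xival R w) - Z1 (xival R w).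
Proof.
move=> [H0 Hr].
have RZ : R 1%N (Z0 w) = Z0 (R 1%N w) + (R 0%N (Z1 w) - Z1 (R 0%N w))
     + (hbar * theta) *: (R 0%N (Z0 w) + Z0 (R 0%N w)).
  rewrite /R /pact; elim/big_rec2: _ => [|k R0 R1 _ E].
    by rewrite !zero_lfunE !linear0; vring.
  rewrite !(add_lfunE, scale_lfunE) E add0n add1n Hr !linearP /=; vring.
have uR x : u *: R 0%N x = xi 0%N x + R 1%N x.
  by rewrite -scale_lfunE Hc // add_lfunE.
rewrite /xival !(linearB, linearD, linearZ) /=.
have := uR (Z0 w); rewrite H0 RZ => E1.
have := congr1 Z0 (uR w); rewrite linearZ linearD /= => E2.
apply: linear_ext => l lD lN lZ l0; move: (congr1 l E1) (congr1 l E2).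
rewrite ?(lD, lN, lZ, l0) => /(congr1 (fun a => hbar * a)) e1.
move=> /(congr1 (fun a => hbar * a)) e2; apply/eqP; rewrite -subr_eq0.
move/eqP: e1; rewrite -subr_eq0 => /eqP e1; move/eqP: e2; rewrite -subr_eq0 => /eqP e2.
apply/eqP; move: (congr2 (fun a b => a - b) e1 e2); rewrite subrr => {e1 e2} <-.
ring.
Qed.

Lemma xival_Yword zs w : currents zs ->
  xival R (Yword (u - hbar * theta) zs w) = Yword (u + hbar * theta) zs (xival R w).
Proof.
elim: zs => //= z zs IH Hzs; rewrite xival_current; last exact/Hzs/mem_head.
by rewrite IH // => y yzs; apply: Hzs; rewrite inE yzs orbT.
Qed.

End Value.

(** Apply [phi] to [xi(u) Y(u - hbar theta) v = Y(u + hbar theta) xi(u) v], with [Y] the word in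
    factors [u Z0 - Z1]. Multiplication by [q] clears the denominators of [mu] and [mu']. *)
Lemma Gpoly_relation q (phi : 'Hom(V, K^o)) v (mu mu' : nat -> K) zs :
  q != 0 -> (forall r, pact q xi r = 0) -> currents zs ->
  (forall r, xi r v = mu r *: v) -> (forall r w, phi (xi r w) = mu' r * phi w) ->
  numer hbar q mu' * (Gpoly phi zs v \Po ('X - (hbar * theta)%:P)) =
  numer hbar q mu * (Gpoly phi zs v \Po ('X + (hbar * theta)%:P)).
Proof.
move=> q0 qxi Hzs Hv Hphi; have [v0|v0] := eqVneq v 0.
  suff -> : Gpoly phi zs v = 0 by rewrite !comp_poly0 !mulr0.
  apply: poly_ext => u; rewrite Gpoly_eval horner0 v0.
  have -> : Yword u zs 0 = 0; last by rewrite linear0.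
  by elim: (zs) => //= z zs' ->; rewrite [z.1 0]linear0 [z.2 0]linear0 scaler0 subr0.
have [phi0|phi0] := eqVneq phi 0.
  suff -> : Gpoly phi zs v = 0 by rewrite !comp_poly0 !mulr0.
  by apply: poly_ext => u; rewrite Gpoly_eval horner0 phi0 zero_lfunE.
have actv p r : pact p (mu : nat -> K^o) r *: v = pact p xi r v.
  rewrite /pact sum_lfunE scaler_suml; apply: eq_bigr => k _.
  by rewrite scale_lfunE Hv scalerA.
have actphi p r w : pact p (mu' : nat -> K^o) r * phi w = phi (pact p xi r w).
  rewrite /pact sum_lfunE linear_sum mulr_suml; apply: eq_bigr => k _.
  by rewrite scale_lfunE linearZ /= Hphi scalerAl.
have qmu r : pact q (mu : nat -> K^o) r = 0.
  apply/eqP; have /eqP := actv q r; rewrite qxi zero_lfunE scaler_eq0 (negbTE v0).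
  by rewrite orbF.
have qmu' r : pact q (mu' : nat -> K^o) r = 0.
  have [w /negbTE w0] := covector_neq0 phi0.
  apply/eqP; have /eqP := actphi q r w; rewrite qxi zero_lfunE linear0 mulf_eq0 w0.
  by rewrite orbF.
apply: (poly_ext_generic q0) => u qu; have [c Hc] := resolvent qu.
have val (m : nat -> K) : (forall r, pact q (m : nat -> K^o) r = 0) ->
    (numer hbar q m).[u] = q.[u] * (1 + hbar * pact c (m : nat -> K^o) 0).
  move=> qm; apply: numer_eval => [r|]; first exact: (Hc _ (m : nat -> K^o)).
  rewrite -pactM mulrC pactM; exact: (etrans (pact_eq _ _ qm) (pact0 _ _ _)).
rewrite !hornerM !horner_comp !hornerD hornerN hornerX !hornerC !val // -!mulrA; congr (_ * _).
rewrite !Gpoly_eval.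
have := congr1 phi (xival_Yword Hc qxi v Hzs).
have -> : xival (fun r => pact c xi r) v = (1 + hbar * pact c (mu : nat -> K^o) 0) *: v.
  by rewrite /xival scalerDl scale1r -scalerA actv.
rewrite /xival linearD linearZ /= -actphi => E.
rewrite [LHS]mulrDl mul1r -mulrA E.
have -> a : Yword (u + hbar * theta) zs (a *: v) = a *: Yword (u + hbar * theta) zs v.
  elim: (zs) => //= z zs' ->; rewrite [z.1 (_ *: _)]linearZ [z.2 (_ *: _)]linearZ /=.
  by rewrite scalerBr !scalerA mulrC.
by rewrite linearZ.
Qed.

End Currents.

(* The relations of the Yangian of sl2 with parameter [hbar * d] that the
   proof uses; [sl2_xm10] is the quadratic relation for r = s = 0. *)
Record sl2_module (K : numClosedFieldType) (hbar d : K) (V : vectType K)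
    (xi xp xm : nat -> 'End(V)) : Prop := Sl2Module {
  sl2_xiC : forall r s w, xi r (xi s w) = xi s (xi r w);
  sl2_xp : forall s, current hbar xi d (xp s) (xp s.+1);
  sl2_xm : forall s, current hbar xi (- d) (xm s) (xm s.+1);
  sl2_xpm : forall r s w, xp r (xm s w) = xm s (xp r w) + xi (r + s)%N w;
  sl2_xm10 : forall w,
    xm 1%N (xm 0%N w) = xm 0%N (xm 1%N w) - (hbar * d) *: xm 0%N (xm 0%N w)
}.

Definition annihilates (K : fieldType) (W : lmodType K) (q : {poly K})
  (F : nat -> W) := forall r, pact q F r = 0.

Lemma annihilatesM (K : fieldType) (W : lmodType K) (p q : {poly K})
  (F : nat -> W) : annihilates q F -> annihilates (p * q) F.
Proof. by move=> H r; rewrite pactM (pact_eq _ _ H) pact0. Qed.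

Lemma annihilates_act (K : fieldType) (W : lmodType K) (p q : {poly K})
  (F : nat -> W) : annihilates q F -> annihilates q (pact p F).
Proof. by move=> H r; rewrite -pactM mulrC; apply: annihilatesM. Qed.

Lemma pact_lfunE (K : fieldType) (V W : vectType K) q (F : nat -> 'Hom(V, W)) r w :
  pact q F r w = pact q (fun k => F k w) r.
Proof. by rewrite /pact sum_lfunE; apply: eq_bigr => k _; rewrite scale_lfunE. Qed.

Lemma pactB (K : fieldType) (W : lmodType K) (q : {poly K}) (F G : nat -> W) r :
  pact q (fun k => F k - G k) r = pact q F r - pact q G r.
Proof. by rewrite /pact -sumrB; apply: eq_bigr => k _; rewrite scalerBr. Qed.

Definition weight (K : fieldType) (V : vectType K) (xi : nat -> 'End(V))
  (mu : nat -> K) := exists2 w, w != 0 & forall r, xi r w = mu r *: w.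

Lemma weight_annihilates (K : fieldType) (V : vectType K) (xi : nat -> 'End(V))
    (mu : nat -> K) q :
  weight xi mu -> annihilates q xi -> annihilates q (mu : nat -> K^o).
Proof.
move=> [w w0 Hw] qxi r; apply/eqP; have /(congr1 (fun g : 'End(V) => g w)) := qxi r.
rewrite zero_lfunE pact_lfunE (pact_eq _ _ (fun k => Hw k)) /pact.
under eq_bigr do rewrite scalerA.
by rewrite -scaler_suml => /eqP; rewrite scaler_eq0 (negbTE w0) orbF.
Qed.

(** * Words in a current on an irreducible module *)

Section Detection.
Variables (K : numClosedFieldType) (hbar theta eps : K) (V : vectType K).
Variables (xi x y : nat -> 'End(V)).
Hypothesis cx : forall s, current hbar xi theta (x s) (x s.+1).
(** The sign [eps] allows [(x, y)] to be [(x^-, x^+)] with [eps = -1] as well as [(x^+, x^-)] with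
    [eps = 1]. *)
Hypothesis xy : forall a r w, x a (y r w) = y r (x a w) + eps *: xi (r + a)%N w.
Hypothesis irr : forall P : V -> Prop,
  P 0 -> (forall a u w, P u -> P w -> P (a *: u + w)) ->
  (forall r w, P w -> [/\ P (xi r w), P (x r w) & P (y r w)]) ->
  (forall w, P w) \/ (forall w, P w -> w = 0).

Lemma Zword_rcons s a w :
  Zword (xword x (rcons s a)) w = Zword (xword x s) (x a w).
Proof. by rewrite /xword map_rcons -cats1 Zword_cat. Qed.

Lemma xi_xE r a w : xi r.+1 (x a w) = x a (xi r.+1 w) +
  (xi r (x a.+1 w) - x a.+1 (xi r w)) + (hbar * theta) *: (xi r (x a w) + x a (xi r w)).
Proof. by case: (cx a) => _ ->. Qed.

Lemma xi0_xE a w : xi 0%N (x a w) = x a (xi 0%N w) + (2 * theta) *: x a w.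
Proof. by case: (cx a) => ->. Qed.

(* Elements all of whose images under words in [x] are killed by an extreme
   covector form a submodule. *)
Lemma word_detects (phi : 'Hom(V, K^o)) (mu : nat -> K) w : phi != 0 ->
  (forall r w, phi (xi r w) = mu r * phi w) -> (forall r w, phi (y r w) = 0) ->
  w != 0 -> exists s, phi (Zword (xword x s) w) != 0.
Proof.
move=> phi0 phixi phiy.
pose N n u := forall s, size s = n -> phi (Zword (xword x s) u) = 0.
have ND n a u u' : N n u -> N n u' -> N n (a *: u + u').
  by move=> Hu Hu' s sn; rewrite Zword_linear linearP /= Hu // Hu' // scaler0 addr0.
have N0 n : N n 0.
  move=> s _; have := Zword_linear (xword x s) (-1) 0 0.
  by rewrite scaler0 addr0 scaleN1r addNr => ->; rewrite linear0.
have NB n u u' : N n u -> N n u' -> N n (u - u').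
  by move=> Hu Hu'; have := ND n (-1) u' u Hu' Hu; rewrite scaleN1r addrC.
have NA n u u' : N n u -> N n u' -> N n (u + u').
  by move=> Hu Hu'; have := ND n 1 u u' Hu Hu'; rewrite scale1r.
have NZ n a u : N n u -> N n (a *: u).
  by move=> Hu; have := ND n a u 0 Hu (N0 n); rewrite addr0.
have NS n u : N n.+1 u <-> forall a, N n (x a u).
  split=> [H a s sn|H s]; first by rewrite -Zword_rcons H // size_rcons sn.
  case/lastP: s => // s a; rewrite size_rcons => -[sn]; rewrite Zword_rcons.
  exact: H.
(* Moving [xi_r] to the left of a letter costs terms in [xi_(r-1)], hence the induction on the
   length of words, then on [r]. *)
have Nxi n r u : N n u -> N n (xi r u).
  elim: n r u => [|n IH] r u.
    by move=> H s /size0nil ->; rewrite /= phixi (H [::]) // mulr0.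
  move=> /NS H; apply/NS; elim: r => [|r IHr] a.
    have -> : x a (xi 0%N u) = xi 0%N (x a u) - (2 * theta) *: x a u.
      by rewrite xi0_xE addrK.
    by apply: NB; [apply: IH | apply: NZ].
  have -> : x a (xi r.+1 u) = xi r.+1 (x a u) - (xi r (x a.+1 u) - x a.+1 (xi r u))
      - (hbar * theta) *: (xi r (x a u) + x a (xi r u)).
    by rewrite xi_xE; vring.
  have Hx b j : N n (xi b (x j u)) by apply: IH.
  by apply: (NB _ _ _ (NB _ _ _ _ (NB _ _ _ _ _)) (NZ _ _ _ (NA _ _ _ _ _))).
have Ny r u : (forall n, N n u) -> forall n, N n (y r u).
  move=> H n; elim: n u H => [|n IH] u H.
    by move=> s /size0nil ->; apply: phiy.
  apply/NS => a; rewrite xy; apply: NA; last exact/NZ/Nxi.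
  by apply: IH => k; apply: (proj1 (NS k u) (H k.+1) a).
have [||r u H|H|H] := irr (P := fun u => forall n, N n u).
- by [].
- by move=> a u u' H H' n; apply: ND.
- by split=> n; [apply: Nxi | apply: (proj1 (NS n u) (H n.+1) r) | apply: Ny].
- have [u] := covector_neq0 phi0; by rewrite (H u 0%N [::]) // eqxx.
move=> w0; apply: contrapT => H'; move/eqP: w0; apply; apply: H => n s _.
by apply: contrapT => /eqP Hs; apply: H'; exists s.
Qed.

Inductive generated (v : V) : V -> Prop :=
| GenBase : generated v v
| GenX r w : generated v w -> generated v (x r w)
| GenLin a u w : generated v u -> generated v w -> generated v (a *: u + w).

(** As [v] is extreme, the relations carry [xi] and [y] through the letters down to [v]; the span of
    the words on [v] is thus a submodule, hence everything, and [psi] cannot vanish on it. *)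
Lemma word_generates (psi : 'Hom(V, K^o)) (mu : nat -> K) v : v != 0 ->
  (forall r, xi r v = mu r *: v) -> (forall r, y r v = 0) ->
  psi != 0 -> exists s, psi (Zword (xword x s) v) != 0.
Proof.
move=> v0 xiv yv psi0.
have g0 : generated v 0.
  by rewrite -(addNr v) -scaleN1r; apply: GenLin; apply: GenBase.
have gZ a u : generated v u -> generated v (a *: u).
  by move=> Hu; rewrite -[_ *: _]addr0; apply: GenLin.
have gA u w : generated v u -> generated v w -> generated v (u + w).
  by move=> Hu Hw; rewrite -[u]scale1r; apply: GenLin.
have gB u w : generated v u -> generated v w -> generated v (u - w).
  by move=> Hu Hw; apply: gA => //; rewrite -scaleN1r; apply: gZ.
have gxi r u : generated v u -> generated v (xi r u).
  move=> Hu; elim: Hu r => [r|a w Hw IH|a w w' _ IHw _ IHw' r].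
  - by rewrite xiv; apply/gZ/GenBase.
  - move=> r; elim: r a => [|r IHr] a.
      by rewrite xi0_xE; apply: gA; [apply/GenX/IH | apply/gZ/GenX].
    rewrite xi_xE; apply: (gA _ _ (gA _ _ (GenX _ (IH _)) _)).
      exact: gB (IHr _) (GenX _ (IH _)).
    exact/gZ/(gA _ _ (IHr _) (GenX _ (IH _))).
  - by rewrite linearP /=; apply: GenLin.
have gy r u : generated v u -> generated v (y r u).
  elim=> [|a w Hw IH|a w w' _ IHw _ IHw'].
  - by rewrite yv.
  - have -> : y r (x a w) = x a (y r w) - eps *: xi (r + a)%N w by rewrite xy addrK.
    by apply: gB; [apply: GenX | apply/gZ/gxi].
  - by rewrite linearP /=; apply: GenLin.
have [||r u H|H|H] := irr (P := generated v) => //.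
- by move=> a u w; apply: GenLin.
- by split; [apply: gxi | apply: GenX | apply: gy].
- apply: contrapT => H'; have [w /negP[]] := covector_neq0 psi0.
  apply/eqP; rewrite -[w]/(Zword (xword x [::]) w).
  elim: (H w) [::] => {w} [s|a w _ IH s|a w w' _ IHw _ IHw' s].
  - by apply: contrapT => /eqP Hs; apply: H'; exists s.
  - by rewrite -Zword_rcons.
  - by rewrite Zword_linear linearP /= IHw IHw' scaler0 addr0.
- by case/eqP: v0; apply/H/GenBase.
Qed.

End Detection.

Section TwistedPeriodic.
Variable K : numFieldType.

(** Eliminating [N] and [N'] shows that [G / H] is periodic with period [b + b]. *)
Lemma twisted_periodic (N N' G H : {poly K}) (b : K) : b != 0 -> N != 0 -> H != 0 ->
  N' * (G \Po ('X - b%:P)) = N * (G \Po ('X + b%:P)) ->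
  N' * (H \Po ('X - b%:P)) = N * (H \Po ('X + b%:P)) ->
  exists c, G = c *: H.
Proof.
move=> b0 N0 H0 EG EH.
apply: (@periodic_ratio _ _ _ (b + b)) => // [|u].
  by rewrite -mulr2n mulrn_eq0.
have E : (G \Po ('X - b%:P)) * (H \Po ('X + b%:P)) =
         (H \Po ('X - b%:P)) * (G \Po ('X + b%:P)).
  apply: (mulfI N0); rewrite mulrCA -EH [RHS]mulrCA -EG; ring.
have := congr1 (fun p : {poly K} => p.[u + b]) E.
by rewrite !hornerM !horner_comp !hornerD hornerN hornerX !hornerC addrK addrA.
Qed.

End TwistedPeriodic.

(** * Annihilators of the three currents *)

Section Module.
Variables (K : numClosedFieldType) (hbar d : K) (V : vectType K).
Variables (xi xp xm : nat -> 'End(V)).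
Hypothesis hbar0 : hbar != 0.
Hypothesis d0 : d != 0.
Hypothesis M : sl2_module hbar d xi xp xm.

Lemma xi0_xm s w : xi 0%N (xm s w) = xm s (xi 0%N w) - (2 * d) *: xm s w.
Proof. by case: (sl2_xm M s) => -> _; rewrite mulrN scaleNr. Qed.

Lemma xi0_xp s w : xi 0%N (xp s w) = xp s (xi 0%N w) + (2 * d) *: xp s w.
Proof. by case: (sl2_xp M s). Qed.

Lemma xi_xpm r s w : xi (r + s)%N w = xp r (xm s w) - xm s (xp r w).
Proof. by rewrite (sl2_xpm M) addrC addKr. Qed.

Lemma pact_xi_xm q r s w :
  pact q xi (r + s)%N w = xp r (pact q xm s w) - pact q xm s (xp r w).
Proof.
rewrite !pact_lfunE pact_apply -pactB; apply: eq_bigr => k _.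
by rewrite -addnA xi_xpm.
Qed.

Lemma pact_xi_xp q r s w :
  pact q xi (r + s)%N w = pact q xp r (xm s w) - xm s (pact q xp r w).
Proof.
rewrite !pact_lfunE pact_apply -pactB; apply: eq_bigr => k _.
by rewrite addnAC xi_xpm.
Qed.

Lemma annihilates_xm_xi q : annihilates q xm -> annihilates q xi.
Proof.
move=> H r; apply/lfunP => w; rewrite -[r]add0n pact_xi_xm H.
by rewrite !zero_lfunE linear0 subrr.
Qed.

(** The commutator of [pact q xp r] with [xm 0] is [pact q xi r], which vanishes; so [pact q xp r]
    is a lowest weight vector of positive weight in [End V]. *)
Lemma annihilates_xi_xp q : annihilates q xi -> annihilates q xp.
Proof.
move=> H r; apply: (@lowest_positive_eq0 _ _ (xm 0%N) (xp 0%N) (- xi 0%N) _ d) => // w.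
- by rewrite opp_lfunE (sl2_xpm M) addrK.
- by rewrite !opp_lfunE xi0_xp linearN opprD.
- by apply/eqP; rewrite eq_sym -subr_eq0 -pact_xi_xp H zero_lfunE.
- have [E _] := current_act q r (sl2_xp M).
  by rewrite !opp_lfunE E linearN opprD.
Qed.

Lemma annihilates_xi_xm q : annihilates q xi -> annihilates q xm.
Proof.
move=> H r; apply: (@lowest_positive_eq0 _ _ (xp 0%N) (xm 0%N) (xi 0%N) _ d) => // w.
- by rewrite (sl2_xpm M).
- exact: xi0_xm.
- by apply/eqP; rewrite -subr_eq0 -pact_xi_xm H zero_lfunE.
- by have [E _] := current_act q r (sl2_xm M); rewrite E mulrN scaleNr.
Qed.

(** A linear relation between the [xm r] gives annihilation at index 0, and [current_zero] carries
    it from each index to the next. *)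
Lemma annihilator_exists : exists2 q : {poly K}, q != 0 & annihilates q xm.
Proof.
have [q q0 Hq] := pact_dependence xm; exists q => //; elim=> [//|r IH].
have d0' : - d != 0 by rewrite oppr_eq0.
have := current_act q r (sl2_xm M); rewrite IH => C0.
exact: (current_zero d0' C0 (current_act q r.+1 (sl2_xm M))).
Qed.

End Module.

(** * Irreducible modules *)

(** [m] and [m'] are the lengths of the strings starting at [v] and at [phi], and [a], [b] those of
    words completing them. The equations say [m' = m + 2a] and [m = m' + 2b]. *)
Fact equal_string_lengths m m' a b :
  (m + m' = (a + m).*2 -> m + m' = (m' + b).*2 -> m = m' /\ a = 0)%N.
Proof. by lia. Qed.

Section Irreducible.
Variables (K : numClosedFieldType) (hbar d : K) (V : vectType K).
Variables (xi xp xm : nat -> 'End(V)).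
Hypothesis hbar0 : hbar != 0.
Hypothesis d0 : d != 0.
Hypothesis M : sl2_module hbar d xi xp xm.
Hypothesis irr : forall P : V -> Prop,
  P 0 -> (forall a u w, P u -> P w -> P (a *: u + w)) ->
  (forall r w, P w -> [/\ P (xi r w), P (xm r w) & P (xp r w)]) ->
  (forall w, P w) \/ (forall w, P w -> w = 0).

Lemma Zword_nseq m (z : 'End(V) * 'End(V)) w :
  Zword (nseq m z) w = iter m z.1 w.
Proof. by elim: m => //= m ->. Qed.

Lemma Yword_nseq u m (z : 'End(V) * 'End(V)) w :
  Yword u (nseq m z) w = iter m (u *: z.1 - z.2) w.
Proof.
by elim: m => //= m ->; rewrite add_lfunE opp_lfunE scale_lfunE.
Qed.

Lemma Yword_cat u zs zs' (w : V) : Yword u (zs ++ zs') w = Yword u zs (Yword u zs' w).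
Proof. exact: foldr_cat. Qed.

Lemma currents_cat theta zs zs' : currents hbar xi theta zs ->
  currents hbar xi theta zs' -> currents hbar xi theta (zs ++ zs').
Proof. by move=> H H' z; rewrite mem_cat => /orP[/H|/H']. Qed.

Lemma currents_nseq theta m z : current hbar xi theta z.1 z.2 ->
  currents hbar xi theta (nseq m z).
Proof. by move=> H y /nseqP[->]. Qed.

Lemma currents_xword theta x s : (forall s, current hbar xi theta (x s) (x s.+1)) ->
  currents hbar xi theta (xword x s).
Proof. by move=> H y /mapP[r _ ->]; apply: H. Qed.

(* Applied to [y = u f - x_1] and [g = f], for which [y f - f y = b f^2]. *)
Lemma iter_shift (y g : 'End(V)) (b : K) m w :
  (forall w, y (g w) = g (y w) + b *: g (g w)) ->
  iter m.+1 (y + b *: g) w = iter m.+1 y w + (b *+ m.+1) *: iter m y (g w).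
Proof.
move=> yg; elim: m w => [|m IH] w; first by rewrite /= add_lfunE scale_lfunE.
rewrite iterSr IH add_lfunE scale_lfunE.
have -> : iter m.+1 y (y w + b *: g w) = iter m.+2 y w + b *: iter m.+1 y (g w).
  by rewrite addrC iter_linear addrC -iterSr.
have -> : iter m y (g (y w + b *: g w)) = iter m.+1 y (g w).
  by rewrite iterSr yg linearD linearZ.
by rewrite -addrA -scalerDl -mulrS.
Qed.

Let f := xm 0%N.
Let e := xp 0%N.
Section ExtremeVectors.
Variables (v : V) (mu mu' : nat -> K) (phi : 'Hom(V, K^o)).
Hypothesis v0 : v != 0.
Hypothesis xiv : forall r, xi r v = mu r *: v.
Hypothesis xpv : forall r, xp r v = 0.
Hypothesis phi0 : phi != 0.
Hypothesis phixi : forall r w, phi (xi r w) = mu' r * phi w.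
Hypothesis phixp : forall r w, phi (xp r w) = 0.

Let xy a r w : xm a (xp r w) = xp r (xm a w) + (-1) *: xi (r + a)%N w.
Proof. by rewrite (sl2_xpm M) scaleN1r addrK. Qed.

Lemma detects w : w != 0 -> exists s, phi (Zword (xword xm s) w) != 0.
Proof. exact: (word_detects (sl2_xm M) xy irr phi0 phixi phixp). Qed.

Lemma generates (psi : 'Hom(V, K^o)) :
  psi != 0 -> exists s, psi (Zword (xword xm s) v) != 0.
Proof. exact: (word_generates (sl2_xm M) xy irr v0 xiv xpv). Qed.

(** By sl2-theory [mu 0 = d m] and [mu' 0 = - d m']. Each letter lowers the weight by [2 d], so a
    word linking [v] to [phi] has length [(m + m') / 2]; completing both strings to such words
    forces [m = m']. *)
Lemma extreme_weights : exists m : nat, [/\ mu 0%N = d * m%:R,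
  phi (iter m f v) != 0 &
  forall zs, currents hbar xi (- d) zs -> phi (Zword zs v) != 0 -> size zs = m].
Proof.
have HF w : xi 0%N (f w) = f (xi 0%N w) - (2 * d) *: f w by apply: (xi0_xm M).
have EF w : e (f w) = f (e w) + xi 0%N w by rewrite /e /f (sl2_xpm M).
have [||m [Dm fmv _]] := sl2_weight (n := mu 0%N / d) d0 EF HF v0.
- exact: xpv.
- by rewrite xiv mulrCA divff // mulr1.
have [|w|m' [Dm' [u fmu]]] := sl2_coweight (n := - mu' 0%N / d) d0 EF HF phi0.
- exact: phixp.
- by rewrite phixi mulrCA divff // mulr1 opprK.
have mu0 : mu 0%N = d * m%:R by rewrite -Dm mulrCA divff // mulr1.
have mu'0 : mu' 0%N = - (d * m'%:R) by rewrite -Dm' mulrCA divff // mulr1 opprK.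
have count zs : currents hbar xi (- d) zs -> phi (Zword zs v) != 0 ->
    (m + m' = (size zs).*2)%N.
  move=> Hzs Hphi; have := Zword_weight Hzs (xiv 0%N).
  move=> /(congr1 phi); rewrite phixi linearZ => /(mulIf Hphi).
  rewrite mu0 mu'0 => E; apply/eqP; rewrite -(eqr_nat K) -subr_eq0.
  have : d * ((m + m')%N%:R - (size zs).*2%:R) = 0.
    transitivity ((d * m%:R + 2 * - d *+ size zs) - - (d * m'%:R)).
      by rewrite -muln2 natrD natrM -mulr_natr; ring.
    by rewrite -E subrr.
  by move/eqP; rewrite mulf_eq0 (negbTE d0).
have cf k : currents hbar xi (- d) (nseq k (xm 0%N, xm 1%N)).
  by apply: currents_nseq; apply: (sl2_xm M).
have cw s : currents hbar xi (- d) (xword xm s).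
  exact/currents_xword/(sl2_xm M).
have [s Hs] := detects fmv.
have E1 : (m + m' = (size s + m).*2)%N.
  rewrite -[in RHS](size_nseq m (xm 0%N, xm 1%N)) -(size_map (fun r => (xm r, xm r.+1)) s).
  rewrite -size_cat; apply: count; first exact: (currents_cat (cw s) (cf m)).
  by rewrite Zword_cat Zword_nseq.
have [t Ht] : exists t, phi (iter m' f (Zword (xword xm t) v)) != 0.
  pose psi := iter m' (transp f) phi.
  have psiE w : psi w = phi (iter m' f w) by rewrite /psi iter_transp.
  have [|t] := @generates psi; last by exists t; rewrite -psiE.
  by apply/eqP => psi0'; move: fmu; rewrite -psiE psi0' zero_lfunE eqxx.
have E2 : (m + m' = (m' + size t).*2)%N.
  rewrite -[in RHS](size_nseq m' (xm 0%N, xm 1%N)) -(size_map (fun r => (xm r, xm r.+1)) t).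
  rewrite -size_cat; apply: count; first exact: (currents_cat (cf m') (cw t)).
  by rewrite Zword_cat Zword_nseq.
have [mm' s0] : m = m' /\ s = [::].
  by have [-> /size0nil] := equal_string_lengths E1 E2.
exists m; split=> // [|zs Hzs /(count _ Hzs)]; first by move: Hs; rewrite s0.
by rewrite -mm' addnn => /double_inj.
Qed.

Definition Zlfun zs : 'End(V) :=
  foldr (fun (z : 'End(V) * 'End(V)) g => (z.1 \o g)%VF) \1%VF zs.

Lemma ZlfunE zs w : Zlfun zs w = Zword zs w.
Proof. by elim: zs => [|z zs IH] /=; rewrite ?id_lfunE // comp_lfunE IH. Qed.

Lemma YwordB u zs (w w' : V) : Yword u zs (w - w') = Yword u zs w - Yword u zs w'.
Proof.
elim: zs => //= z zs ->; rewrite [z.1 (_ - _)]linearB [z.2 (_ - _)]linearB /=.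
by vring.
Qed.

Lemma YwordZ u zs a (w : V) : Yword u zs (a *: w) = a *: Yword u zs w.
Proof.
elim: zs => //= z zs ->; rewrite [z.1 (_ *: _)]linearZ [z.2 (_ *: _)]linearZ /=.
by rewrite scalerBr !scalerA mulrC.
Qed.

Section LowestEigenvalue.
Variable m : nat.
Hypothesis mu0 : mu 0%N = d * m%:R.
Hypothesis fmv : phi (iter m f v) != 0.
Hypothesis count : forall zs, currents hbar xi (- d) zs ->
  phi (Zword zs v) != 0 -> size zs = m.

Let c0 := phi (iter m f v) : K.
Let p0 := Gpoly phi (nseq m (xm 0%N, xm 1%N)) v.

(** The monic multiple of [phi((u x^-_0 - x^-_1)^m v)], which turns out to be the Drinfeld
    polynomial of [mu]. *)
Definition baxter : {poly K} := c0^-1 *: p0.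

Let p0E : p0 = c0 *: baxter.
Proof. by rewrite scalerA divff // scale1r. Qed.

Let cf k : currents hbar xi (- d) (nseq k (xm 0%N, xm 1%N)).
Proof. exact/currents_nseq/(sl2_xm M). Qed.

Let p0m : p0`_m = c0.
Proof.
by have := coef_Gpoly phi (nseq m (xm 0%N, xm 1%N)) v; rewrite size_nseq Zword_nseq.
Qed.

Lemma size_baxter : size baxter = m.+1.
Proof.
rewrite size_scale ?invr_eq0 //; apply/eqP; rewrite eqn_leq; apply/andP; split.
  by have := size_Gpoly phi (nseq m (xm 0%N, xm 1%N)) v; rewrite size_nseq.
by rewrite ltnNge; apply: contraNN fmv => /leq_sizeP/(_ _ (leqnn _)) H; rewrite -/c0 -p0m H.
Qed.

Lemma baxter_monic : baxter \is monic.
Proof. by rewrite monicE lead_coefE size_baxter coefZ p0m mulVf. Qed.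

(* All the polynomials [Gpoly phi zs v] solve the same first-order difference
   equation, so they are proportional. *)
Lemma Gpoly_baxter zs : currents hbar xi (- d) zs -> size zs = m ->
  Gpoly phi zs v = (phi (Zword zs v) : K) *: baxter.
Proof.
move=> Hzs sz; have [q q0 /(annihilates_xm_xi M) qxi] := annihilator_exists d0 M.
have N0 : numer hbar q mu != 0 by rewrite -size_poly_gt0 size_numer // size_poly_gt0.
have b0 : hbar * - d != 0 by rewrite mulf_neq0 // oppr_eq0.
have p0n0 : p0 != 0 by apply: contraNneq fmv => E; rewrite -/c0 -p0m E coef0.
have [c E] := twisted_periodic b0 N0 p0n0
  (Gpoly_relation q0 qxi Hzs xiv phixi) (Gpoly_relation q0 qxi (@cf m) xiv phixi).
have := coef_Gpoly phi zs v; rewrite sz E coefZ p0m => <-.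
by rewrite -scalerA -p0E.
Qed.

(** It suffices to test on words: [phi] detects and [v] generates. The values [F k] of a word with
    one letter of varying index [k] are then shown to satisfy the recurrence. *)
Lemma baxter_annihilates : annihilates baxter xm.
Proof.
move=> r; apply/eqP; apply: contraT => D0.
have [w /detects[s Hs]] : exists w, pact baxter xm r w != 0.
  apply: contrapT => H; move/eqP: D0; apply; apply/lfunP => w; rewrite zero_lfunE.
  by apply: contrapT => /eqP Hw; apply: H; exists w.
have [|t] := @generates (phi \o (Zlfun (xword xm s) \o pact baxter xm r))%VF.
  by apply: contraNneq Hs => /(congr1 (fun g : 'Hom(V, K^o) => g w));
    rewrite !comp_lfunE ZlfunE zero_lfunE => ->.
rewrite !comp_lfunE ZlfunE.
pose zs k := xword xm s ++ (xm k, xm k.+1) :: xword xm t.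
have Hzs k : currents hbar xi (- d) (zs k).
  have cw s' : currents hbar xi (- d) (xword xm s').
    exact/currents_xword/(sl2_xm M).
  apply: currents_cat (cw s) _ => z; rewrite inE => /orP[/eqP->|/cw //].
  exact: (sl2_xm M).
pose F k : K^o := phi (Zword (zs k) v).
have -> : phi (Zword (xword xm s) (pact baxter xm r (Zword (xword xm t) v))) =
    pact baxter F r.
  rewrite -ZlfunE pact_lfunE !pact_apply; apply: pact_eq => k.
  by rewrite ZlfunE /F Zword_cat.
have [sz|sz] := eqVneq (size (zs 0%N)) m; last first.
  suff F0 k : F k = 0 by rewrite (pact_eq _ _ F0) pact0 eqxx.
  apply/eqP; apply: contraNT sz => /(count (Hzs k)).
  by rewrite !size_cat /= => ->.
have szk k : size (zs k) = m by rewrite -sz !size_cat.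
(* The pair [(0, - xm k)] puts the factor [xm k], free of [u], in place of [u xm_k - xm_(k+1)]. *)
pose H k := Gpoly phi (xword xm s ++ (0, - xm k) :: xword xm t) v.
have HF k : 'X * H k - H k.+1 = (F k : K) *: baxter.
  rewrite -Gpoly_baxter //; apply: poly_ext => u.
  rewrite hornerD hornerN hornerM hornerX !Gpoly_eval !Yword_cat /= !opp_lfunE !zero_lfunE.
  by rewrite !scaler0 !sub0r !opprK YwordB YwordZ linearB linearZ.
(* Reading off degree [l] in [HF] at index [r + l] makes the sum telescope; the value 0 at [l = 0]
   is the coefficient of degree -1. *)
pose a l : K := if l is l'.+1 then (H (r + l)%N)`_l' else 0.
have aE l : baxter`_l *: F (r + l)%N = - (a l.+1 - a l).
  have := congr1 (fun p : {poly K} => p`_l) (HF (r + l)%N).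
  rewrite coefB coefXM coefZ mulrC => E.
  rewrite -[LHS]/(baxter`_l * F (r + l)%N) -E.
  by rewrite opprB /a addnS; case: (l).
rewrite /pact (eq_bigr _ (fun l _ => aE _)) sumrN.
rewrite -(big_mkord xpredT (fun l => a l.+1 - a l)) telescope_sumr // size_baxter subr0.
(* This is the coefficient of degree [m] of an [H k], that is, the value of a word with the letter
   0. *)
suff -> : a m.+1 = 0 by rewrite oppr0 eqxx.
have := coef_Gpoly phi (xword xm s ++ (0, - xm (r + m.+1)%N) :: xword xm t) v.
have -> : size (xword xm s ++ (0, - xm (r + m.+1)%N) :: xword xm t) = m.
  by rewrite -sz !size_cat.
by rewrite /a /H => ->; rewrite Zword_cat /= zero_lfunE -ZlfunE !linear0.
Qed.

(** If [R] is the resolvent of [xm] at [a], then [a R_0 - R_1 = xm 0]. The polynomial of the word of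
    [m] letters [(R_0, R_1)] therefore takes at [a] the value [phi(f^m v) != 0], and it is a
    multiple of [baxter]. *)
Lemma baxter_root q a : annihilates q xm -> q.[a] != 0 -> baxter.[a] != 0.
Proof.
move=> qxm qa; have [c Hc] := resolvent qa.
pose z := (pact c xm 0, pact c xm 1).
have cz : currents hbar xi (- d) (nseq m z).
  exact/currents_nseq/(current_act _ _ (sl2_xm M)).
have := congr1 (fun p : {poly K} => p.[a]) (Gpoly_baxter cz (size_nseq _ _)).
rewrite Gpoly_eval Yword_nseq hornerZ /=.
have -> : a *: pact c xm 0 - pact c xm 1 = xm 0%N by rewrite (Hc _ _ qxm) addrK.
by move=> E; apply: contraNneq fmv => a0; rewrite E a0 mulr0.
Qed.

(** Let [y = u x^-_0 - x^-_1], so that [baxter] at [u + hbar d] is [phi((y + hbar d f)^m v)] up to a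
    constant. By [iter_shift] this is [phi(y^m v) + m hbar d phi(y^(m-1) f v)], and the last term is
    a word whose final factor is [f = u R_0 - R_1], with [R] the resolvent. *)
Lemma baxter_drinfeld : numer hbar baxter mu = baxter \Po ('X + (hbar * d)%:P).
Proof.
have b0 : baxter != 0 by apply/monic_neq0/baxter_monic.
have pxm := baxter_annihilates; have pxi := annihilates_xm_xi M pxm.
have pmu : annihilates baxter (mu : nat -> K^o).
  by apply: (weight_annihilates _ pxi); exists v.
apply: (poly_ext_generic b0) => u pu; have [c Hc] := resolvent pu.
rewrite (@numer_eval _ _ _ _ _ (pact c (mu : nat -> K^o))); first last.
- exact: annihilates_act.
- by move=> r; apply: (Hc _ (mu : nat -> K^o)).
rewrite horner_comp hornerD hornerX hornerC.
set rho := pact c _ 0%N; pose R := pact c xm.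
have uR w : u *: R 0%N w = xm 0%N w + R 1%N w.
  by rewrite -scale_lfunE (Hc _ _ pxm) add_lfunE.
have eRv : e (R 0%N v) = rho *: v.
  transitivity (pact c xi 0 v).
    by rewrite -[0%N in RHS]addn0 (pact_xi_xm M) xpv linear0 subr0.
  rewrite pact_lfunE (pact_eq _ _ xiv) /rho /pact scaler_suml.
  by apply: eq_bigr => k _; rewrite scalerA.
have EF w : e (f w) = f (e w) + xi 0%N w by rewrite /e /f (sl2_xpm M).
have HF w : xi 0%N (f w) = f (xi 0%N w) - (2 * d) *: f w by apply: (xi0_xm M).
have bE b : Yword b (nseq m (xm 0%N, xm 1%N)) v = iter m (b *: xm 0%N - xm 1%N) v.
  exact: Yword_nseq.
have p0_eval b : c0 * baxter.[b] = phi (iter m (b *: xm 0%N - xm 1%N) v).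
  by rewrite -hornerZ -p0E Gpoly_eval bE.
apply: (mulfI fmv); rewrite -/c0 mulrA !p0_eval.
(* For [m = 0] a division by [m] is impossible, but then [phi v != 0] while [phi] kills the image of
   [e], which forces [rho = 0]. *)
case Dm: m => [|m'].
  have -> : rho = 0; last by rewrite mulr0 addr0 mulr1.
  have := congr1 phi eRv; rewrite phixp linearZ => /esym/eqP.
  rewrite mulf_eq0 => /orP[/eqP //|]; move: fmv; rewrite Dm /= => /negbTE -> //.
have shift : (u + hbar * d) *: xm 0%N - xm 1%N =
    (u *: xm 0%N - xm 1%N) + (hbar * d) *: xm 0%N by rewrite scalerDl addrAC.
rewrite shift iter_shift => [|w]; last first.
  rewrite !(add_lfunE, opp_lfunE, scale_lfunE) (sl2_xm10 M) !(linearB, linearZ) /=.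
  vring.
rewrite linearD mulrDr mulr1; congr (_ + _); rewrite -Dm -p0_eval.
(* [al] is chosen so that [e] kills [R_0 v - al f v]; by sl2-theory this vector of weight
   [d * (m - 2)] is then killed by [f^(m-1)]. *)
pose al := rho / (d * m%:R).
have m0 : m%:R != 0 :> K by rewrite Dm pnatr_eq0.
have fR : phi (iter m' f (R 0%N v)) = al * c0 :> K.
  pose w := R 0%N v - al *: f v.
  have ew : e w = 0.
    rewrite linearB linearZ /= eRv EF [e v]xpv linear0 add0r xiv mu0 scalerA.
    by rewrite divfK ?subrr // mulf_neq0.
  have xiw : xi 0%N w = (d * (m%:R - 2)) *: w.
    have [HR _] := current_act c 0%N (sl2_xm M).
    rewrite linearB linearZ /= HR HF !xiv mu0 !linearZ /=; vring.
  have fw : iter m' f w = 0.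
    have [->|w0] := eqVneq w 0; first exact: iter_lin0.
    have [k [Hk _ Fk]] := sl2_weight d0 EF HF w0 ew xiw.
    suff -> : m' = k.+1 by [].
    apply/eqP; rewrite -(eqr_nat K) -[k.+1]addn1 natrD -Hk Dm.
    by rewrite -[m'.+1]addn1 natrD; apply/eqP; ring.
  have -> : R 0%N v = al *: f v + w by rewrite /w addrC subrK.
  by rewrite iter_linear fw addr0 linearZ /= -iterSr -Dm.
pose zs := nseq m' (xm 0%N, xm 1%N) ++ [:: (R 0%N, R 1%N)].
have czs : currents hbar xi (- d) zs.
  apply: currents_cat => // z; rewrite inE => /eqP ->.
  exact: (current_act _ _ (sl2_xm M)).
have szs : size zs = m by rewrite size_cat size_nseq addn1 Dm.
have := congr1 (fun p : {poly K} => p.[u]) (Gpoly_baxter czs szs).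
rewrite Gpoly_eval hornerZ Yword_cat Yword_nseq Zword_cat Zword_nseq /= uR addrK fR.
rewrite linearZ /= => ->.
have scaleE (a b : K) : a *: (b : K^o) = a * b by [].
by rewrite scaleE -[_ *+ m]mulr_natr /al; field; rewrite d0 m0.
Qed.

End LowestEigenvalue.

End ExtremeVectors.
End Irreducible.

(** * Drinfeld polynomials and the poles of irreducible modules *)

Section DrinfeldPolynomials.
Variables (K : numClosedFieldType) (hbar d : K).
Implicit Types (mu : nat -> K) (P q : {poly K}).

Definition drinfeld mu P := [/\ P \is monic, annihilates P (mu : nat -> K^o)
  & numer hbar P mu = P \Po ('X + (hbar * d)%:P)].

Lemma drinfeld_eval mu P q c u : drinfeld mu P ->
  (forall (W : lmodType K) (F : nat -> W), (forall r, pact q F r = 0) ->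
    forall r, u *: pact c F r = F r + pact c F r.+1) ->
  annihilates q (mu : nat -> K^o) ->
  P.[u + hbar * d] = P.[u] * (1 + hbar * pact c (mu : nat -> K^o) 0).
Proof.
move=> [_ Pmu numP] Hc qmu.
rewrite -(@numer_eval _ _ _ mu _ (pact c (mu : nat -> K^o))) => [|r|].
- by rewrite numP horner_comp hornerD hornerX hornerC.
- exact: (Hc _ (mu : nat -> K^o)).
- exact: annihilates_act.
Qed.

Hypothesis hbar0 : hbar != 0.
Hypothesis d0 : d != 0.

Let b0 : hbar * d != 0. Proof. by rewrite mulf_neq0. Qed.

(** The quotient [P' / P] is periodic with period [hbar d]. *)
Lemma drinfeld_unique mu P P' : drinfeld mu P -> drinfeld mu P' -> P = P'.
Proof.
move=> DP DP'; have [mP Pmu _] := DP; have [mP' _ _] := DP'.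
have [|c E] := periodic_ratio b0 (monic_neq0 mP) (g := P').
  have -> : (forall u, P'.[u] * P.[u + hbar * d] = P.[u] * P'.[u + hbar * d]) <->
    P' * (P \Po ('X + (hbar * d)%:P)) = P * (P' \Po ('X + (hbar * d)%:P)).
    split=> [H|/(congr1 (fun p : {poly K} => p.[_])) H u].
      by apply: poly_ext => u; rewrite !hornerM !horner_comp hornerD hornerX hornerC.
    by have := H u; rewrite !hornerM !horner_comp hornerD hornerX hornerC.
  apply: (poly_ext_generic (monic_neq0 mP)) => u Pu; have [c Hc] := resolvent Pu.
  rewrite !hornerM !horner_comp hornerD hornerX hornerC.
  rewrite (drinfeld_eval DP Hc Pmu) (drinfeld_eval DP' Hc Pmu); ring.
have := monicP mP'; rewrite E lead_coefZ (monicP mP) mulr1 => ->.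
by rewrite scale1r.
Qed.

End DrinfeldPolynomials.

Section Poles.
Variables (K : numClosedFieldType) (hbar d : K) (V : vectType K).
Variables (xi xp xm : nat -> 'End(V)).
Hypothesis hbar0 : hbar != 0.
Hypothesis d0 : d != 0.
Hypothesis M : sl2_module hbar d xi xp xm.

Definition irreducible_module := forall P : V -> Prop,
  P 0 -> (forall a u w, P u -> P w -> P (a *: u + w)) ->
  (forall r w, P w -> [/\ P (xi r w), P (xm r w) & P (xp r w)]) ->
  (forall w, P w) \/ (forall w, P w -> w = 0).

Definition regular_point (x : nat -> 'End(V)) (a : K) :=
  exists2 q : {poly K}, q.[a] != 0 & annihilates q x.

Definition poles_are_roots := forall a, ~ regular_point xm a <->
  exists mu P, [/\ weight xi mu, drinfeld hbar d mu P & root P a].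

(* With [t] the polynomial of a path from [w] up to the highest weight vector,
   [P t t(. - hbar d)] is a scalar multiple of [p]. *)
Lemma dominant_root (v : V) mu p mu2 P a : irreducible_module ->
  v != 0 -> (forall r, xi r v = mu r *: v) -> (forall r, xp r v = 0) ->
  annihilates p xm -> drinfeld hbar d mu p ->
  weight xi mu2 -> drinfeld hbar d mu2 P -> root P a -> root p a.
Proof.
move=> irr v0 xiv xpv pxm Dp wt2 DP Pa.
have [mp _ nump] := Dp; have [mP _ _] := DP; have p0 := monic_neq0 mp.
have pxi := annihilates_xm_xi M pxm.
have V0 : {:V}%VS != 0%VS.
  by apply: contraNneq v0 => V0; rewrite -memv0 -V0 memvf.
have [||chi [chi0 [mu'' chixi] chixm]] :=
    @extreme_covector _ V nat xi xm (- (2 * d)) _ V0 (sl2_xiC M).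
- by rewrite oppr_eq0 mulf_neq0 // pnatr_eq0.
- by move=> s w; rewrite (xi0_xm M) scaleNr.
have xy r s w : xp r (xm s w) = xm s (xp r w) + 1 *: xi (s + r)%N w.
  by rewrite (sl2_xpm M) scale1r addnC.
have det := word_detects (sl2_xp M) xy _ chi0 chixi chixm.
have irr' : forall Q : V -> Prop,
  Q 0 -> (forall a u w, Q u -> Q w -> Q (a *: u + w)) ->
  (forall r w, Q w -> [/\ Q (xi r w), Q (xp r w) & Q (xm r w)]) ->
  (forall w, Q w) \/ (forall w, Q w -> w = 0).
  by move=> Q Q0 QD QM; apply: irr => // r w /(QM r)[].
(* A word detecting [v] must be empty, as [xp] kills [v]; hence [chi v != 0], and [chi] has the same
   weight [mu] as [v]. *)
have chiv : chi v != 0.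
  have [s] := det irr' v v0; case/lastP: s => // s r.
  have -> : Zword (xword xp (rcons s r)) v = 0.
    by rewrite /xword map_rcons -cats1 Zword_cat /= xpv -ZlfunE linear0.
  by rewrite linear0 eqxx.
have mu''E r : mu'' r = mu r.
  by apply: (mulIf chiv); rewrite -chixi xiv linearZ.
have [w w0 xiw] := wt2; have [s Hs] := det irr' w w0.
pose t := Gpoly chi (xword xp s) w.
have t0 : t != 0.
  apply: contraNneq Hs => t0; rewrite -coef_Gpoly -/t t0 coef0 //.
have := Gpoly_relation (theta := d) p0 pxi (currents_xword (s:=s) (sl2_xp M)) xiw chixi.
have -> : mu'' = mu by apply/funext.
rewrite nump -/t => Et.
have pmu2 := weight_annihilates wt2 pxi.
pose b := hbar * d; pose G := P * t * (t \Po ('X - b%:P)).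
have [||c Gc] := @periodic_ratio _ G p b _ p0.
- by rewrite mulf_neq0.
- move=> u.
  (* Combine [p(x + b) t(x - b) = p(x) mu2(x) t(x + b)] with [P(x + b) = P(x) mu2(x)]: the quotient
     [G / p] is [b]-periodic. *)
  have : G * (p \Po ('X + b%:P)) = p * (G \Po ('X + b%:P)).
    apply: (poly_ext_generic p0) => x px; have [c Hc] := resolvent px.
    have := congr1 (fun q : {poly K} => q.[x]) Et.
    rewrite /G !(hornerM, horner_comp, hornerD, hornerN, hornerX, hornerC).
    rewrite (@numer_eval _ _ _ mu2 _ (pact c (mu2 : nat -> K^o))); first last.
    - exact: annihilates_act.
    - by move=> r; apply: (Hc _ (mu2 : nat -> K^o)).
    rewrite (drinfeld_eval DP Hc pmu2) addrK => E.
    transitivity (P.[x] * t.[x] * (p.[x + b] * t.[x - b])); first by ring.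
    rewrite E; ring.
  move/(congr1 (fun q : {poly K} => q.[u])).
  by rewrite /G !(hornerM, horner_comp, hornerD, hornerN, hornerX, hornerC).
have G0 : G != 0.
  apply: mulf_neq0; first exact: mulf_neq0 (monic_neq0 mP) t0.
  apply: contraNneq t0 => tb0; apply/eqP.
  by apply: poly_ext => u; have := congr1 (fun q : {poly K} => q.[u + b]) tb0;
    rewrite /= horner_comp hornerD hornerN hornerX hornerC addrK !horner0.
have c0 : c != 0 by apply: contraNneq G0 => c0; rewrite Gc c0 scale0r.
have := congr1 (fun q : {poly K} => q.[a]) Gc.
rewrite hornerZ !hornerM (rootP Pa) !mul0r => /esym/eqP.
by rewrite mulf_eq0 (negbTE c0).
Qed.

Lemma irreducible_poles : {:V}%VS != 0%VS -> irreducible_module -> poles_are_roots.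
Proof.
move=> V0 irr a.
have d20 : 2 * d != 0 by rewrite mulf_neq0 // pnatr_eq0.
have [v [v0 [mu xiv] xpv]] := extreme_vector d20 V0 (sl2_xiC M) (xi0_xp M).
have [phi [phi0 [mu' phixi] phixp]] := extreme_covector d20 V0 (sl2_xiC M) (xi0_xp M).
have [m [mu0 fmv count]] := extreme_weights d0 M irr v0 xiv xpv phi0 phixi phixp.
pose p := baxter xm v phi m.
have pxm : annihilates p xm.
  exact: (baxter_annihilates hbar0 d0 M irr v0 xiv xpv phi0 phixi phixp fmv count).
have Dp : drinfeld hbar d mu p.
  split.
  - exact: (baxter_monic fmv).
  - by apply: (weight_annihilates _ (annihilates_xm_xi M pxm)); exists v.
  - exact: (baxter_drinfeld hbar0 d0 M irr v0 xiv xpv phi0 phixi phixp mu0 fmv count).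
split=> [Hreg|[mu2 [P [wt2 DP Pa]]] [q qa qxm]].
  exists mu, p; split=> //; first by exists v.
  by apply: contrapT => /negP pa; apply: Hreg; exists p.
have := baxter_root hbar0 d0 M xiv phixi fmv qxm qa.
by apply/negP; rewrite negbK; apply: (dominant_root irr v0 xiv xpv pxm Dp wt2 DP).
Qed.

End Poles.

(** * Extensions *)

Section Submodule.
Variables (K : numClosedFieldType) (hbar d : K) (V W : vectType K).
Variables (xi xp xm : nat -> 'End(V)) (xi' xp' xm' : nat -> 'End(W)).
Variable i : 'Hom(W, V).
Hypothesis i_inj : forall w, i w = 0 -> w = 0.
Hypothesis i_xi : forall r w, i (xi' r w) = xi r (i w).
Hypothesis i_xp : forall r w, i (xp' r w) = xp r (i w).
Hypothesis i_xm : forall r w, i (xm' r w) = xm r (i w).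

Let inj w w' : i w = i w' -> w = w'.
Proof.
move/eqP; rewrite -subr_eq0 -linearB => /eqP /i_inj /eqP.
by rewrite subr_eq0 => /eqP.
Qed.

Lemma current_sub theta (Z0 Z1 : 'End(V)) (Z0' Z1' : 'End(W)) :
  (forall w, i (Z0' w) = Z0 (i w)) -> (forall w, i (Z1' w) = Z1 (i w)) ->
  current hbar xi theta Z0 Z1 -> current hbar xi' theta Z0' Z1'.
Proof.
move=> iZ0 iZ1 [H0 Hr]; split=> [w|r w]; apply: inj;
  rewrite !(linearD, linearB, linearZ) /= !(i_xi, iZ0, iZ1).
- exact: H0.
- by rewrite Hr linearN /= iZ1 i_xi.
Qed.

Lemma sl2_module_sub : sl2_module hbar d xi xp xm -> sl2_module hbar d xi' xp' xm'.
Proof.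
case=> C Cp Cm Cpm Cq; split.
- by move=> r s w; apply: inj; rewrite !i_xi C.
- by move=> s; apply: current_sub (Cp s).
- by move=> s; apply: current_sub (Cm s).
- by move=> r s w; apply: inj; rewrite linearD /= !(i_xp, i_xm, i_xi) Cpm.
- by move=> w; apply: inj; rewrite linearB linearZ /= !i_xm Cq.
Qed.

End Submodule.

Section Quotient.
Variables (K : numClosedFieldType) (hbar d : K) (V W : vectType K).
Variables (xi xp xm : nat -> 'End(V)) (xi' xp' xm' : nat -> 'End(W)).
Variable pi : 'Hom(V, W).
Hypothesis pi_surj : forall w, exists v, pi v = w.
Hypothesis pi_xi : forall r v, pi (xi r v) = xi' r (pi v).
Hypothesis pi_xp : forall r v, pi (xp r v) = xp' r (pi v).
Hypothesis pi_xm : forall r v, pi (xm r v) = xm' r (pi v).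

Lemma current_quotient theta (Z0 Z1 : 'End(V)) (Z0' Z1' : 'End(W)) :
  (forall v, pi (Z0 v) = Z0' (pi v)) -> (forall v, pi (Z1 v) = Z1' (pi v)) ->
  current hbar xi theta Z0 Z1 -> current hbar xi' theta Z0' Z1'.
Proof.
move=> pZ0 pZ1 [H0 Hr]; split=> [w|r w]; have [v <-] := pi_surj w.
- by rewrite -!(pi_xi, pZ0) H0 linearD linearZ.
- rewrite -!(pi_xi, pZ0, pZ1) Hr linearD linearZ linearD linearB /=.
  by rewrite linearD.
Qed.

Lemma sl2_module_quotient :
  sl2_module hbar d xi xp xm -> sl2_module hbar d xi' xp' xm'.
Proof.
case=> C Cp Cm Cpm Cq; split.
- by move=> r s w; have [v <-] := pi_surj w; rewrite -!pi_xi C.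
- by move=> s; apply: current_quotient (Cp s).
- by move=> s; apply: current_quotient (Cm s).
- move=> r s w; have [v <-] := pi_surj w.
  by rewrite -pi_xm -!pi_xp -pi_xm -pi_xi Cpm linearD.
- by move=> w; have [v <-] := pi_surj w; rewrite -!pi_xm Cq linearB linearZ.
Qed.

End Quotient.

(** The quotient is modelled on the complement [U^C] with the projection along [U]; the dimensions
    serve the induction in [sl2_poles]. *)
Lemma invariant_split (K : fieldType) (V : vectType K) (U : {vspace V}) :
  exists (W1 W2 : vectType K) (i : 'Hom(W1, V)) (pi : 'Hom(V, W2))
    (c1 : 'End(V) -> 'End(W1)) (c2 : 'End(V) -> 'End(W2)),
  [/\ dim W1 = \dim U, dim W2 = (dim V - \dim U)%N,
      forall w, i w = 0 -> w = 0, forall w, exists v, pi v = w &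
      (forall v, pi v = 0 <-> exists w, v = i w) /\
      forall g : 'End(V), (forall v, v \in U -> g v \in U) ->
        (forall w, i (c1 g w) = g (i w)) /\ (forall v, pi (g v) = c2 g (pi v))].
Proof.
pose i : 'Hom(subvs_of U, V) := linfun vsval.
pose j : 'Hom(subvs_of U^C, V) := linfun vsval.
pose p1 : 'Hom(V, subvs_of U) := linfun (vsproj U).
pose pi : 'Hom(V, subvs_of U^C) := (linfun (vsproj U^C) \o daddv_pi U^C U)%VF.
have UC0 : (U :&: U^C = 0)%VS by apply: capv_compl.
have UC0' : (U^C :&: U = 0)%VS by rewrite capvC.
have pi_add v : daddv_pi U^C U v + daddv_pi U U^C v = v.
  by apply: (daddv_pi_add UC0'); rewrite addvC addv_complf memvf.
have piE v : pi v = 0 <-> v \in U.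
  rewrite comp_lfunE lfunE /=; split=> [/(congr1 vsval)|vU].
    rewrite vsprojK ?memv_pi // => p0.
    by rewrite -(pi_add v) p0 add0r memv_pi.
  have := pi_add v; rewrite (daddv_pi_id UC0 vU) => /eqP.
  by rewrite -subr_eq0 addrK => /eqP ->; rewrite linear0.
exists (subvs_of U), (subvs_of U^C), i, pi, (fun g => p1 \o g \o i)%VF,
  (fun g => pi \o g \o j)%VF.
split.
- by [].
- by rewrite -[dim V]dimvf; apply: dimv_compl.
- by move=> w; rewrite lfunE => w0; apply: subvs_inj; rewrite linear0.
- move=> w; exists (vsval w); rewrite comp_lfunE lfunE /=.
  by rewrite daddv_pi_id ?subvsP // vsvalK.
split=> [v|g gU].
  rewrite piE; split=> [vU|[w ->]]; last by rewrite lfunE subvsP.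
  by exists (vsproj U v); rewrite lfunE /= vsprojK.
split=> [w|v].
  by rewrite !comp_lfunE !lfunE /= vsprojK // gU ?subvsP.
have jpi : j (pi v) = daddv_pi U^C U v.
  by rewrite lfunE /pi comp_lfunE lfunE /= vsprojK ?memv_pi.
have -> : (pi \o g \o j)%VF (pi v) = pi (g (daddv_pi U^C U v)).
  by rewrite -jpi comp_lfunE comp_lfunE.
rewrite -{1}(pi_add v) !linearD [X in _ + X](_ : _ = 0) ?addr0 //.
exact/piE/gU/memv_pi.
Qed.

Lemma pact_intertwine (K : fieldType) (V W : vectType K) (g : 'Hom(V, W))
    (x : nat -> 'End(V)) (x' : nat -> 'End(W)) q r v :
  (forall r v, g (x r v) = x' r (g v)) -> g (pact q x r v) = pact q x' r (g v).
Proof.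
by move=> gx; rewrite !pact_lfunE pact_apply; apply: eq_bigr => k _; rewrite gx.
Qed.

Section Extension.
Variables (K : numClosedFieldType) (hbar d : K) (V W1 W2 : vectType K).
Variables (xi xp xm : nat -> 'End(V)).
Variables (xi1 xp1 xm1 : nat -> 'End(W1)) (xi2 xp2 xm2 : nat -> 'End(W2)).
Variables (i : 'Hom(W1, V)) (pi : 'Hom(V, W2)).
Hypothesis d0 : d != 0.
Hypothesis M : sl2_module hbar d xi xp xm.
Hypothesis M1 : sl2_module hbar d xi1 xp1 xm1.
Hypothesis M2 : sl2_module hbar d xi2 xp2 xm2.
Hypothesis i_inj : forall w, i w = 0 -> w = 0.
Hypothesis pi_surj : forall w, exists v, pi v = w.
Hypothesis exact_V : forall v, pi v = 0 <-> exists w, v = i w.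
Hypothesis i_xi : forall r w, i (xi1 r w) = xi r (i w).
Hypothesis i_xp : forall r w, i (xp1 r w) = xp r (i w).
Hypothesis i_xm : forall r w, i (xm1 r w) = xm r (i w).
Hypothesis pi_xi : forall r v, pi (xi r v) = xi2 r (pi v).
Hypothesis pi_xp : forall r v, pi (xp r v) = xp2 r (pi v).
Hypothesis pi_xm : forall r v, pi (xm r v) = xm2 r (pi v).

(* Let [q] annihilate both ends.  Then the sequences obtained by applying [q] to
   [x^+] and to [x^-] map V to W1 and kill W1, so that they have zero products. *)
Lemma annihilates_extension q :
  annihilates q xm1 -> annihilates q xm2 -> annihilates (q * q) xm.
Proof.
move=> q1 q2; apply: (annihilates_xi_xm d0 M) => r; apply/lfunP => w.
have imp (x : nat -> 'End(V)) (x1 : nat -> 'End(W1)) (x2 : nat -> 'End(W2)) s v :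
    (forall r w, i (x1 r w) = x r (i w)) ->
    (forall r v, pi (x r v) = x2 r (pi v)) ->
    annihilates q x1 -> annihilates q x2 ->
    (exists u, pact q x s v = i u) /\ (forall u, pact q x s (i u) = 0).
  move=> ix pix qx1 qx2; split=> [|u].
    by apply/exact_V; rewrite (pact_intertwine _ _ _ pix) qx2 zero_lfunE.
  by rewrite -(pact_intertwine _ _ _ ix) qx1 zero_lfunE linear0.
have impm s v := imp xm xm1 xm2 s v i_xm pi_xm q1 q2.
have p1 := annihilates_xi_xp d0 M1 (annihilates_xm_xi M1 q1).
have p2 := annihilates_xi_xp d0 M2 (annihilates_xm_xi M2 q2).
have impp s v := imp xp xp1 xp2 s v i_xp pi_xp p1 p2.
rewrite zero_lfunE pactM pact_lfunE.
transitivity (pact q xp 0 (pact q xm r w) - pact q xm r (pact q xp 0 w)).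
  rewrite [pact q xp 0 _]pact_lfunE [pact q xp 0 w]pact_lfunE pact_apply -pactB.
  by apply: eq_bigr => k _; rewrite add0n addnC (pact_xi_xm M).
have [[u ->] _] := impm r w; have [_ ->] := impp 0%N 0.
by have [[u' ->] _] := impp 0%N w; have [_ ->] := impm r 0; rewrite subrr.
Qed.

Lemma regular_point_extension a :
  regular_point xm a <-> regular_point xm1 a /\ regular_point xm2 a.
Proof.
split=> [[q qa qxm]|[[q1 qa1 qxm1] [q2 qa2 qxm2]]].
  split; exists q => // r; apply/lfunP => w; rewrite zero_lfunE.
    by apply: i_inj; rewrite (pact_intertwine _ _ _ i_xm) qxm zero_lfunE.
  have [v <-] := pi_surj w.
  by rewrite -(pact_intertwine _ _ _ pi_xm) qxm zero_lfunE linear0.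
exists (q1 * q2 * (q1 * q2)); first by rewrite !hornerM !mulf_neq0.
apply: annihilates_extension; last exact: annihilatesM.
by rewrite mulrC; apply: annihilatesM.
Qed.

(** An eigenvector of [V] lies in the submodule or has a nonzero image; conversely
    [lift_eigenvector] lifts those of the quotient. *)
Lemma weight_extension mu : weight xi mu <-> weight xi1 mu \/ weight xi2 mu.
Proof.
split=> [[w w0 xiw]|[[w w0 xiw]|[w w0 xiw]]].
- have [|pw] := eqVneq (pi w) 0.
    move/exact_V => [u wu]; left; exists u.
      by apply: contraNneq w0 => u0; rewrite wu u0 linear0.
    move=> r; apply/eqP; rewrite -subr_eq0; apply/eqP/i_inj.
    by rewrite linearB linearZ /= i_xi -wu xiw subrr.
  by right; exists (pi w) => // r; rewrite -pi_xi xiw linearZ.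
- exists (i w); first by apply: contraNneq w0 => /i_inj ->.
  by move=> r; rewrite -i_xi xiw linearZ.
- have [v pv] := pi_surj w; rewrite -pv in w0 xiw.
  have [u u0 xiu] := lift_eigenvector (sl2_xiC M) pi_xi w0 xiw.
  by exists u.
Qed.

Lemma poles_are_roots_extension : poles_are_roots hbar d xi1 xm1 ->
  poles_are_roots hbar d xi2 xm2 -> poles_are_roots hbar d xi xm.
Proof.
move=> H1 H2 a; split=> [nreg|[mu [P [/weight_extension[wt|wt] DP Pa]]]].
- have [reg1|/H1[mu [P [wt DP Pa]]]] := pselect (regular_point xm1 a).
    have [reg2|/H2[mu [P [wt DP Pa]]]] := pselect (regular_point xm2 a).
      by case: nreg; apply/regular_point_extension.
    by exists mu, P; split=> //; apply/weight_extension; right.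
  by exists mu, P; split=> //; apply/weight_extension; left.
- move/regular_point_extension => [reg _]; apply: (proj2 (H1 a)) reg.
  by exists mu, P.
- move/regular_point_extension => [_ reg]; apply: (proj2 (H2 a)) reg.
  by exists mu, P.
Qed.

End Extension.

(** Induction on the dimension: a reducible module is an extension of modules of smaller
    dimension. *)
Lemma sl2_poles (K : numClosedFieldType) (hbar d : K) (V : vectType K)
    (xi xp xm : nat -> 'End(V)) : hbar != 0 -> d != 0 ->
  sl2_module hbar d xi xp xm -> poles_are_roots hbar d xi xm.
Proof.
move=> hbar0 d0; have [n] := ubnP (dim V).
elim: n V xi xp xm => // n IH V xi xp xm dimV M.
have [V0|V0] := eqVneq {:V}%VS 0%VS.
  have v0 (v : V) : v = 0 by apply/eqP; rewrite -memv0 -V0 memvf.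
  move=> a; split=> [[]|[mu [P [[w w0 _] _ _]]]]; last by rewrite (v0 w) eqxx in w0.
  exists 1; rewrite ?hornerC ?oner_neq0 // => r.
  by apply/lfunP => v; apply: etrans (v0 _) (esym (v0 _)).
have [irr|] := pselect (irreducible_module xi xp xm).
  exact: irreducible_poles M V0 irr.
move=> /existsNP[P /not_implyP[P0 /not_implyP[PD /not_implyP[PM]]]].
move=> /not_orP[/existsNP[v nPv] /existsNP[w /not_implyP[Pw w0]]].
have [U UP] := vspace_of_pred P0 PD.
have U0 : (0 < \dim U)%N.
  rewrite lt0n dimv_eq0; apply/negP => /eqP U0.
  by move/UP: Pw; rewrite U0 memv0 => /eqP.
have U1 : (\dim U < dim V)%N.
  rewrite ltn_neqAle -dimvf dimvS ?subvf // andbT; apply/negP => UV.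
  apply: nPv; apply/UP; suff -> : U = fullv by rewrite memvf.
  by apply/eqP; rewrite eqEdim subvf (eqP UV) leqnn.
have [W1 [W2 [i [pi [c1 [c2 [dim1 dim2 i_inj pi_surj [exV Hc]]]]]]]] := invariant_split U.
have Uxi r u : u \in U -> xi r u \in U by move/UP => /(PM r)[? _ _]; apply/UP.
have Uxm r u : u \in U -> xm r u \in U by move/UP => /(PM r)[_ ? _]; apply/UP.
have Uxp r u : u \in U -> xp r u \in U by move/UP => /(PM r)[_ _ ?]; apply/UP.
have i_xi r := proj1 (Hc _ (Uxi r)); have pi_xi r := proj2 (Hc _ (Uxi r)).
have i_xp r := proj1 (Hc _ (Uxp r)); have pi_xp r := proj2 (Hc _ (Uxp r)).
have i_xm r := proj1 (Hc _ (Uxm r)); have pi_xm r := proj2 (Hc _ (Uxm r)).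
have M1 := sl2_module_sub i_inj i_xi i_xp i_xm M.
have M2 := sl2_module_quotient pi_surj pi_xi pi_xp pi_xm M.
apply: (poles_are_roots_extension d0 M M1 M2 i_inj pi_surj exV i_xi i_xp i_xm
  pi_xi pi_xp pi_xm).
- by apply: IH M1; rewrite dim1; apply: leq_trans U1 _.
- apply: IH M2; rewrite dim2 -ltnS; apply: leq_trans dimV.
  by rewrite ltnS ltn_subrL U0 (ltn_trans U0 U1).
Qed.

(** The vectors killed by powers of each [xi r - mu r] form a subspace stable under the commuting
    [xi]; a joint eigenvector in it can only have the eigenvalues [mu]. *)
Lemma generalized_weight (K : numClosedFieldType) (V : vectType K)
    (xi : nat -> 'End(V)) (mu : nat -> K) v :
  (forall r s w, xi r (xi s w) = xi s (xi r w)) -> v != 0 ->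
  (forall r, exists N, iter N (fun w => xi r w - mu r *: w) v = 0) ->
  weight xi mu.
Proof.
move=> xiC v0 Hv; pose n r : 'End(V) := xi r - mu r *: \1%VF.
have nE r w : n r w = xi r w - mu r *: w.
  by rewrite add_lfunE opp_lfunE scale_lfunE id_lfunE.
have [||U HU] := @vspace_of_pred K V (fun w => forall r, exists N, iter N (n r) w = 0).
- by move=> r; exists 0%N.
- move=> a x y Hx Hy r; have [N Nx] := Hx r; have [N' Ny] := Hy r.
  exists (N + N')%N; rewrite iter_linear [iter _ _ y]iterD Ny iter_lin0 addr0.
  by rewrite addnC iterD Nx iter_lin0 scaler0.
have [||w [/HU wU w0 [a Ha]]] := @joint_eigenvector K V nat xi U xiC.
- apply: contraNneq v0 => U0; rewrite -memv0 -U0; apply/HU => r.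
  by have [N HN] := Hv r; exists N; rewrite -[RHS]HN; apply: eq_iter.
- move=> s w /HU Hw; apply/HU => r; have [N HN] := Hw r; exists N.
  suff -> : iter N (n r) (xi s w) = xi s (iter N (n r) w) by rewrite HN linear0.
  elim: N {HN} => //= N ->.
  by rewrite !nE xiC [RHS]linearB; congr (_ - _); rewrite linearZ.
exists w => // r; have [N HN] := wU r.
have nw : n r w = (a r - mu r) *: w by rewrite nE Ha scalerBl.
move/eqP: HN; rewrite (iter_eigen _ nw) scaler_eq0 (negbTE w0) orbF expf_eq0.
by rewrite subr_eq0 => /andP[_ /eqP aE]; rewrite Ha aE.
Qed.

(** * The rank-one subalgebra of the Yangian *)

Section YangianModule.
Variables (R : realType) (L : simpleLieData R) (hbar : R[i]).
Variables (V : yangianModule L hbar) (i : ind L).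

Lemma root_form_neq0 : root_form i i != 0.
Proof.
have [Hroot _ _] := srootP L; have := root_length_ge2 (Hroot i).
by move=> le2; apply/negP => /eqP E; move: le2; rewrite -/(root_form i i) E lern0.
Qed.

Lemma symmetrizer_neq0 : symmetrizer i != 0.
Proof. by rewrite mulf_neq0 ?root_form_neq0 // invr_eq0 pnatr_eq0. Qed.

Lemma symmetrizer_cartan : symmetrizer i * cartan_entry i i = 2 * symmetrizer i.
Proof.
rewrite /symmetrizer /cartan_entry; field.
by rewrite root_form_neq0.
Qed.

(** Since [d_i a_ii = 2 d_i], the relations for [j = i] are those of a current with
    [theta = e d_i]. *)
Lemma cartan_current e (x : ind L -> nat -> 'End(V)) :
  cartan_relations hbar e (xi_op V) x ->
  forall s, current hbar (xi_op V i) (e * symmetrizer i) (x i s) (x i s.+1).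
Proof.
move=> [H0 Hr] s; split=> [w|r w].
  have /(congr1 (fun g : 'End(V) => g w)) := H0 i i s.
  rewrite /comm add_lfunE opp_lfunE scale_lfunE !comp_lfunE => /eqP.
  by rewrite subr_eq symmetrizer_cartan mulrCA addrC => /eqP ->.
have /(congr1 (fun g : 'End(V) => g w)) := Hr i i r s.
rewrite /comm /acomm !(add_lfunE, opp_lfunE, scale_lfunE, comp_lfunE) => /eqP.
rewrite symmetrizer_cartan [2 * _]mulrC mulfK ?pnatr_eq0 // subr_eq subr_eq => /eqP ->.
rewrite mulrCA; vring.
Qed.

Lemma yangian_sl2_module :
  sl2_module hbar (symmetrizer i) (xi_op V i) (xp_op V i) (xm_op V i).
Proof.
have [C [Cp Cm] [_ Qm] PM _] := yangian_modP V.
split.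
- move=> r s w; have /(congr1 (fun g : 'End(V) => g w)) := C i i r s.
  rewrite /comm add_lfunE opp_lfunE !comp_lfunE zero_lfunE => /eqP.
  by rewrite subr_eq0 => /eqP.
- by move=> s; have := cartan_current Cp s; rewrite mul1r.
- by move=> s; have := cartan_current Cm s; rewrite mulN1r.
- move=> r s w; have /(congr1 (fun g : 'End(V) => g w)) := PM i i r s.
  rewrite eqxx /comm add_lfunE opp_lfunE !comp_lfunE => /eqP.
  by rewrite subr_eq addrC => /eqP.
- move=> w; have /(congr1 (fun g : 'End(V) => g w)) := Qm i i 0%N 0%N.
  rewrite /comm /acomm !(add_lfunE, opp_lfunE, scale_lfunE, comp_lfunE).
  rewrite symmetrizer_cartan [2 * symmetrizer i]mulrC mulfK ?pnatr_eq0 // => E.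
  (* For [r = s = 0] the two commutators are opposite, so the relation comes out doubled. *)
  apply: (@scalerI _ _ 2); first by rewrite pnatr_eq0.
  apply/eqP; rewrite -subr_eq0; apply/eqP; move/eqP: E; rewrite -subr_eq0 => /eqP E.
  rewrite -[RHS]E; vring.
Qed.

End YangianModule.

Theorem proposition6p5 (R : realType) (L : simpleLieData R) (hbar : R[i])
    (hbar_neq0 : hbar != 0) (V : yangianModule L hbar) (i : ind L) :
  sigma V i =
  \bigcup_(mu in dominant_weights V i) zeros (drinfeld_poly hbar i (mu i)).
Proof.
have M := yangian_sl2_module V i; have d0 := symmetrizer_neq0 i.
have regP (c : 'End(V)) (x : nat -> 'End(V)) a :
    regular_at (series_inf c (fun r => hbar *: x r)) a <-> regular_point x a.
  rewrite regular_atP; split=> -[q qa Hq]; exists q => // r.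
    have /eqP := Hq r; rewrite pact_scale scaler_eq0 (negbTE hbar_neq0) /=.
    by move/eqP.
  by rewrite pact_scale Hq scaler0.
have DP mu P : is_drinfeld_poly hbar i mu P <-> drinfeld hbar (symmetrizer i) mu P.
  split=> [[mP /(expansion_ofP _ _ _ hbar_neq0)[_ Pmu numP]]|[mP Pmu numP]].
    by split.
  by split=> //; apply/(expansion_ofP _ _ _ hbar_neq0); split; rewrite ?monic_neq0.
(* The three currents share their annihilators, so a regular point of [xm] is regular for all;
   [annihilator_exists] supplies the rationality that [is_pole] demands. *)
have sigmaP a : sigma V i a <-> ~ regular_point (xm_op V i) a.
  split=> [poles [q qa qxm]|nreg].
    have qxi := annihilates_xm_xi M qxm; have qxp := annihilates_xi_xp d0 M qxi.
    by case: poles => -[_]; apply; apply/regP; exists q.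
  apply: Or33; split; last by move/regP.
  have [q q0 qxm] := annihilator_exists d0 M.
  have [|P HP] := annihilator_expansion (F := fun r => hbar *: xm_op V i r) 0 q0.
    by move=> r; rewrite pact_scale qxm scaler0.
  by exists P, q.
have drinfeld_polyP mu P : drinfeld hbar (symmetrizer i) mu P ->
    drinfeld_poly hbar i mu = P.
  move=> DmuP; apply: (drinfeld_unique hbar_neq0 d0 _ DmuP); apply/DP.
  by apply: (@xgetPex _ 1 [set P | is_drinfeld_poly hbar i mu P]); exists P; apply/DP.
apply/seteqP; split=> a.
  move/sigmaP/(sl2_poles hbar_neq0 d0 M) => [mu [P [[w w0 xiw] DmuP Pa]]].
  have xiC j s k r v : xi_op V j s (xi_op V k r v) = xi_op V k r (xi_op V j s v).
    have [C _ _ _ _] := yangian_modP V.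
    have /(congr1 (fun g : 'End(V) => g v)) := C j k s r.
    rewrite /comm add_lfunE opp_lfunE !comp_lfunE zero_lfunE => /eqP.
    by rewrite subr_eq0 => /eqP.
  (* [mu] concerns the index [i] alone; a joint eigenvector of all [xi_op V j s] inside the
     eigenspace of [mu] completes it to a full tuple. *)
  have [||U HU] := @vspace_of_pred _ V (fun v => forall r, xi_op V i r v = mu r *: v).
  - by move=> r; rewrite linear0 scaler0.
  - move=> b x y Hx Hy r.
    by rewrite linearP /= Hx Hy scalerDr !scalerA mulrC.
  have [|||v [/HU vU v0 [b Hb]]] := @joint_eigenvector _ V (ind L * nat)%type
      (fun t => xi_op V t.1 t.2) U.
  - by move=> s t v; apply: xiC.
  - by apply: contraNneq w0 => U0; rewrite -memv0 -U0; apply/HU.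
  - by move=> t v /HU Hv; apply/HU => r; rewrite xiC Hv linearZ.
  have bmu : (fun r => b (i, r)) = mu.
    apply/funext => r; have /eqP := Hb (i, r); rewrite /= vU -subr_eq0 -scalerBl.
    by rewrite scaler_eq0 (negbTE v0) orbF subr_eq0 => /eqP.
  exists (fun j r => b (j, r)) => /=; last by rewrite bmu /zeros /= (drinfeld_polyP _ _ DmuP).
  split; last by exists P; rewrite bmu; apply/DP.
  exists v; last exact/eqP.
  by move=> j k; exists 1%N => //=; rewrite (Hb (j, k)) subrr.
move=> [mu [[v Hv /eqP v0] [P /DP DmuP]] Pa].
rewrite /zeros /= (drinfeld_polyP _ _ DmuP) in Pa.
apply/sigmaP/(sl2_poles hbar_neq0 d0 M); exists (mu i), P; split=> //.
apply: (generalized_weight (sl2_xiC M) v0) => r.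
by have [N _ HN] := Hv i r; exists N.
Qed.
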